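(* Let $(H,\langle\cdot,\cdot\rangle_H)$ be a real finite-dimensional Hilbert space, let $k$ be an integer with $1\le k\le\dim H$, and let $\mu$ be a $\sigma$-finite nonnegative Borel measure on $H$. (a) Let $\alpha>0$ and suppose there is a finite constant $C_\alpha$ such that $\mu(B)\le C_\alpha|B|_k^\alpha$ for all ellipsoids $B$ in $H$. Then for all $0<p_j<\infty$ ($j=1,\dots,k+1$) and $\gamma$ which satisfy $\frac1{p_j}<\frac{\gamma}{k\alpha}$ for $j=1,\dots,k+1$ and $\sum_{j=1}^{k+1}\frac1{p_j}=\frac\gamma\alpha$, there is a finite constant $C$ (independent of the functions $f_j$; for the fixed $H$ and $\mu$ it depends only on $p_j,k,\gamma$) such that $$\prod_{j=1}^{k+1}\|f_j\|_{L^{p_j}(d\mu)}\le C\,\sup_{y_1,\dots,y_{k+1}}\ \prod_{j=1}^{k+1}f_j(y_j)\,\det(y_1,\dots,y_{k+1})^\gamma$$ for all nonnegative functions $f_j\in L^{p_j}(d\mu)$, $j=1,\dots,k+1$. (b) Conversely, suppose that for some $p_j>0$ ($j=1,\dots,k+1$) and $\gamma>0$ there is a finite constant $C$ such that the displayed inequality in (a) holds for all nonnegative functions $f_j\in L^{p_j}(d\mu)$, $j=1,\dots,k+1$. Then, with $\alpha=\gamma\left(\sum_{j=1}^{k+1}\frac1{p_j}\right)^{-1}$, there is a finite constant $C_\alpha$ such that $\mu(B)\le C_\alpha|B|_k^\alpha$ for all ellipsoids $B$ in $H$.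
   Context: $\sup$ denotes the essential supremum with respect to the product measure $\mu\otimes\cdots\otimes\mu$ on $H^{k+1}$. For $0<p<\infty$, $\|f\|_{L^p(d\mu)}=(\int|f|^p\,d\mu)^{1/p}$ (also for $p<1$). For $y_1,\dots,y_{k+1}\in H$, $\det(y_1,\dots,y_{k+1})\ge0$ denotes the square root of the determinant of the $k\times k$ Gram matrix $(a_{i,j})$ with $a_{i,j}=\langle y_i-y_{k+1},y_j-y_{k+1}\rangle_H$. A subset $B\subset H$ is an ellipsoid if it can be written as $B=\{x\in H:\sum_i \frac{|\langle x-x_0,\omega_i\rangle|^2}{l_i^2}\le1\}$ for some $x_0\in H$, some orthonormal basis $\{\omega_i\}$ of $H$ and lengths $l_i\in[0,\infty]$ (a term with $l_i=\infty$ is $0$; $l_i=0$ forces $\langle x-x_0,\omega_i\rangle=0$). Its $k$-content is $|B|_k=\sup\{l_{i_1}\cdots l_{i_k}: i_1<i_2<\dots<i_k\}$, with the convention $0\cdot\infty=0$. *)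

(* Defs.v *)
From HB Require Import structures.
From mathcomp Require Import all_boot all_order all_algebra.
From mathcomp Require Import all_classical all_reals all_analysis.
From mathcomp Require Import ess_sup_inf hoelder.

Set Implicit Arguments.
Unset Strict Implicit.
Unset Printing Implicit Defensive.

Import Order.TTheory GRing.Theory Num.Theory.
Import numFieldNormedType.Exports.

Local Open Scope classical_set_scope.
Local Open Scope ring_scope.

(* Real finite-dimensional Hilbert spaces: [vectType] gives finite dimension
   (hence completeness), and the norm is the one of the inner product. *)
#[short(type="normedVectType")]
HB.structure Definition NormedVector (R : realType) :=
  {H of NormedModule R H & Vector R H}.

HB.mixin Record isHilbert (R : realType) H of NormedVector R H := {
  inner : {dot H for (@idfun R)};
  inner_norm : forall x : H, `|x| = Num.sqrt (inner x x)
}.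

#[short(type="finHilbertType")]
HB.structure Definition FinHilbert (R : realType) :=
  {H of NormedVector R H & isHilbert R H}.

Arguments inner {R s}.

Definition borel (R : realType) (H : finHilbertType R) :=
  g_sigma_algebraType (@open H).

(* The n-fold product of a sigma-finite measure with itself, on n-tuples. *)
Section power_measure.
Context d (T : measurableType d) (R : realType).

Definition tcons n (p : (T * n.-tuple T)%type) : n.+1.-tuple T :=
  [the n.+1.-tuple T of p.1 :: p.2].

Definition tuncons n (t : n.+1.-tuple T) : (T * n.-tuple T)%type :=
  (thead t, [tuple of behead t]).

Lemma measurable_tcons n : measurable_fun setT (@tcons n).
Proof. exact: measurable_cons. Qed.

Lemma measurable_tuncons n : measurable_fun setT (@tuncons n).
Proof.
apply: measurable_fun_pair; last exact: measurable_behead.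
exact: measurable_tnth.
Qed.

Lemma tconsK n : cancel (@tcons n) (@tuncons n).
Proof.
by move=> [x t]; rewrite /tuncons /tcons; congr pair; exact: val_inj.
Qed.

Section tcons_measure.
Variables (mu : {sigma_finite_measure set T -> \bar R}) (n : nat).
Variable nu : {sigma_finite_measure set (n.-tuple T) -> \bar R}.

Definition tcons_measure := pushforward (mu \x nu)%E (@tcons n).

Let tcons_measure0 : tcons_measure set0 = 0%E.
Proof. by rewrite /tcons_measure /pushforward preimage_set0 measure0. Qed.

Let tcons_measure_ge0 A : (0 <= tcons_measure A)%E.
Proof. exact: (measure_ge0 (mu \x nu)%E). Qed.

Let tcons_measure_sigma_additive : semi_sigma_additive tcons_measure.
Proof.
move=> F mF tF mUF; rewrite /tcons_measure /pushforward preimage_bigcup.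
apply: measure_semi_sigma_additive.
- by move=> i; rewrite -[X in measurable X]setTI; exact: measurable_tcons.
- apply/trivIsetP => /= i j _ _ ij; rewrite -preimage_setI.
  by move/trivIsetP : tF => /(_ _ _ _ _ ij) ->//; rewrite preimage_set0.
- by rewrite -preimage_bigcup -[X in measurable X]setTI; exact: measurable_tcons.
Qed.

HB.instance Definition _ := isMeasure.Build _ _ _ tcons_measure
  tcons_measure0 tcons_measure_ge0 tcons_measure_sigma_additive.

Let tcons_measure_sigma_finite : sigma_finite setT tcons_measure.
Proof.
have /sigma_finiteP[F [TF ndF Foo]] := sigma_finiteT mu.
have /sigma_finiteP[G [TG ndG Goo]] := sigma_finiteT nu.
exists (fun i => @tuncons n @^-1` (F i `*` G i)).
  rewrite -preimage_bigcup -[LHS](preimage_setT (@tuncons n)); congr (_ @^-1` _).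
  rewrite -setXTT TF TG predeqE => -[x y]; split; last first.
    by move=> [i _ []/= ? ?]; split; exists i.
  move=> [/= [i _ Fix] [j _ Gjy]]; exists (maxn i j) => //; split.
  - by move: x Fix; exact/subsetPset/ndF/leq_maxl.
  - by move: y Gjy; exact/subsetPset/ndG/leq_maxr.
move=> i; have [mF Fioo] := Foo i; have [mG Gioo] := Goo i; split.
  by rewrite -[X in measurable X]setTI; apply: measurable_tuncons => //;
    exact: measurableX.
rewrite /tcons_measure /pushforward -comp_preimage.
rewrite (_ : tuncons (n:=n) \o tcons (n:=n) = id) ?preimage_id//; last first.
  by apply/funext => p; exact: tconsK.
by rewrite product_measure1E// lte_mul_pinfty// ge0_fin_numE.
Qed.

HB.instance Definition _ := Measure_isSigmaFinite.Build _ _ _ tcons_measure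
  tcons_measure_sigma_finite.

End tcons_measure.

Variable mu : {sigma_finite_measure set T -> \bar R}.

Fixpoint power_measure n : {sigma_finite_measure set (n.-tuple T) -> \bar R} :=
  match n with
  | 0 => dirac [tuple]
  | n'.+1 => tcons_measure mu (power_measure n')
  end.

Lemma power_measure_box n (A : 'I_n -> set T) :
  (forall i, measurable (A i)) ->
  power_measure n [set t | forall i, A i (tnth t i)] =
  (\prod_(i < n) mu (A i))%E.
Proof.
elim: n A => [|n IHn] A mA.
  by rewrite big_ord0 /= diracE mem_set//= => -[i i_lt0].
have mbox : measurable [set t : n.-tuple T | forall i, A (lift ord0 i) (tnth t i)].
  rewrite (_ : [set _ | _] = \bigcap_(i in [set: 'I_n])
      ((fun t : n.-tuple T => tnth t i) @^-1` A (lift ord0 i))); last first.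
    by apply/seteqP; split => t /= tA i; [move=> _; exact: tA|exact: (tA i)].
  apply: fin_bigcap_measurable => // i _.
  by rewrite -[X in measurable X]setTI; exact: measurable_tnth.
rewrite big_ord_recl -IHn// -product_measure1E//=.
rewrite /tcons_measure /pushforward; congr (_ \x _)%E.
apply/seteqP; split => -[x t] /=.
  move=> tA; split; first exact: (tA ord0).
  by move=> i; have := tA (lift ord0 i); rewrite tnthS.
move=> [xA tA] i; case: (unliftP ord0 i) => [j ->|->//].
by rewrite tnthS.
Qed.

End power_measure.

Section ellipsoids.
Context (R : realType) (H : finHilbertType R).
Local Notation n := (\dim {:H}).

Definition orthonormal_basis (w : n.-tuple H) :=
  basis_of fullv w && orthonormal inner w.

(* In [\bar R], 0^-1 = +oo, +oo^-1 = 0 and 0 * +oo = 0, so that a term with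
   l i = +oo vanishes, while l i = 0 forces inner (x - x0) w_i = 0. *)
Definition ellipsoid (x0 : H) (w : n.-tuple H) (l : 'I_n -> \bar R) : set H :=
  [set x | (\sum_(i < n) (`|inner (x - x0) (tnth w i)| ^+ 2)%:E / l i ^+ 2 <= 1)%E].

(* The indices i_1 < ... < i_k are given as the k-subset they form. *)
Definition kcontent (k : nat) (l : 'I_n -> \bar R) : \bar R :=
  ereal_sup [set (\prod_(i in S) l i)%E | S in [set S : {set 'I_n} | #|S| = k]].

Definition ellipsoid_bound (mu : set H -> \bar R) (k : nat) (alpha : R) :=
  exists2 C : R, 0 <= C &
  forall (x0 : H) (w : n.-tuple H) (l : 'I_n -> \bar R),
    orthonormal_basis w -> (forall i, (0 <= l i)%E) ->
    (mu (ellipsoid x0 w l) <= C%:E * kcontent k l `^ alpha)%E.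

End ellipsoids.

Section determinant_inequality.
Context (R : realType) (H : finHilbertType R) (k : nat).

Definition gram_det (y : k.+1.-tuple H) : R :=
  let v (i : 'I_k) := tnth y (widen_ord (leqnSn k) i) - tnth y ord_max in
  Num.sqrt (\det (\matrix_(i < k, j < k) inner (v i) (v j))).

Variable mu : {sigma_finite_measure set (borel H) -> \bar R}.

(* For mu = 0 the library gives ess_sup = -oo, not 0; the inequality then
   still holds, with C = 0. *)
Definition det_inequality (p : 'I_k.+1 -> R) (gamma : R) :=
  exists2 C : R, 0 <= C &
  forall f : 'I_k.+1 -> borel H -> R,
    (forall j, [/\ measurable_fun setT (f j), (forall x, 0 <= f j x) &
                   finite_norm mu (p j)%:E (f j)]) ->
    (\prod_(j < k.+1) 'N[mu]_(p j)%:E [EFin \o f j] <=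
     C%:E * ess_sup (power_measure mu k.+1)
       (fun y => ((\prod_(j < k.+1) f j (tnth y j)) *
                  gram_det y `^ gamma)%:E))%E.

End determinant_inequality.

(* Main.v *)
Require Import Defs.
From mathcomp Require Import all_boot all_order all_algebra all_fingroup.
From mathcomp Require Import all_classical all_reals all_analysis.
From mathcomp Require Import measurable_realfun ess_sup_inf hoelder.
From mathcomp Require Import lra ring zify.

(** The determinant [det(y_1, ..., y_(k+1))] is the volume of the parallelotope
spanned by the differences with the last point; it is the square root of a Gram
determinant, and by Cauchy-Binet it is comparable with the largest coordinate
minor in any orthonormal basis ([gram_basis_minor]). Put
[q = k alpha / gamma]: the conditions on the exponents then read [q < p_j] and
[\sum_j 1 / p_j = k / q].

Part (a) rests on an endpoint estimate ([prod_le_gram]): for sets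
[F_1, ..., F_k] and a base point [x0], the product of the [mu(F_i)] is at most
[C s^(k alpha)], where [s] is the supremum of [det(y_1, ..., y_k, x0)] over
[y_i] in [F_i]. It combines two facts.

- One set. Choosing points of [F] greedily, each almost as far as possible from
the span of the previous ones, yields an orthonormal basis in which [F] lies in
a box whose [k]-content is comparable with the volume spanned by [k] points of
[F] ([greedy_basis]). So [mu(F)] is at most a constant times the power [alpha]
of that volume ([bounded_measure_le_gram]).

- [k] sets. The product of the volumes spanned by [k] points inside each [F_i]
is at most [C s^k] ([mixed_minors], [gram_mixed]). The statement is affine
invariant, so one may take as basis vectors [y_i] in [F_i] that maximize the
mixed volume. Exchanging one, two or three of the [y_i] cannot increase it,
which bounds by absolute constants the products of coordinates along short
cycles ([cycle_bounds]), such as the [j]-th coordinate of a point of [F_i]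
times the [i]-th coordinate of a point of [F_j]. Pairing the coordinate bounds
in this way bounds the product of all volumes. When [k] is less than the
dimension, the determinants are made square by adding the orthonormal basis as
further families.

Applied to the level sets of the [f_j], with each index [i] in turn providing
the base point, the endpoint estimate bounds the supremum of [f_i^q] times the
weak [L^1] quasinorms of the other [f_j^q] by [C A^q], where [A] is the
essential supremum on the right-hand side ([prod_level_sets_le]). The level
sets are first reduced to their essential points, where the essential supremum
is a pointwise bound ([exists_essential_subset], [essential_gram_le]). Each
[L^(p_j)] norm is interpolated between the weak [L^q] quasinorm and the
supremum ([integral_le_weak]), and a weighted geometric mean of the [k + 1]
inequalities gives the product of the norms ([det_inequality_finite]).

Part (b) tests the inequality with indicators of an ellipsoid [B]: the
determinant is at most [C |B|_k] on it ([gram_det_ellipsoid_le]). *)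

Set Implicit Arguments.
Unset Strict Implicit.
Unset Printing Implicit Defensive.

Import Order.TTheory GRing.Theory Num.Theory.
Import numFieldNormedType.Exports.

Local Open Scope classical_set_scope.
Local Open Scope ring_scope.

(** * Determinants *)

(** Reindexing the terms of the Leibniz formula by columns lets the bound on a
term depend on the row that the permutation assigns to each column. *)
Lemma norm_det_le_perm (R : realDomainType) n (A : 'M[R]_n) (B : R) :
  (forall s : 'S_n, \prod_j `|A ((s^-1)%g j) j| <= B) -> `|\det A| <= n`!%:R * B.
Proof.
move=> AB; rewrite /determinant; apply: le_trans (ler_norm_sum _ _ _) _.
have -> : n`!%:R * B = \sum_(s : 'S_n) B by rewrite sumr_const card_Sn mulr_natl.
apply: ler_sum => s _; rewrite normrM normrX normrN1 expr1n mul1r normr_prod.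
rewrite (reindex_inj (@perm_inj _ s^-1%g)) /=.
by under eq_bigr do rewrite permKV; exact: AB.
Qed.

Lemma norm_det_le (R : realDomainType) n (A : 'M[R]_n) (b : 'I_n -> R) :
  (forall i j, `|A i j| <= b j) -> `|\det A| <= n`!%:R * \prod_j b j.
Proof.
move=> Ab; apply: norm_det_le_perm => s.
by apply: ler_prod => j _; rewrite normr_ge0 Ab.
Qed.

(** The sum runs over all maps [f] that choose [k] columns, instead of over
[k]-subsets: non-injective maps contribute nothing and each subset is counted
[k!] times, which is where the factor on the left comes from. Expanding
[A *m A^T] by rows gives a sum over [f] of a product of entries times one
minor; averaging over the precompositions of [f] with a permutation turns the
product into a second copy of the minor. *)
Lemma cauchy_binet (R : comPzRingType) k n (A : 'M[R]_(k, n)) :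
  k`!%:R * \det (A *m A^T) =
  \sum_(f : {ffun 'I_k -> 'I_n}) \det (colsub f A) ^+ 2.
Proof.
have E1 : \det (A *m A^T) =
    \sum_(f : {ffun 'I_k -> 'I_n}) (\prod_i A i (f i)) * \det (colsub f A).
  transitivity (\sum_(s : 'S_k) \sum_(f : {ffun 'I_k -> 'I_n})
      (-1) ^+ s * \prod_i (A i (f i) * A (s i) (f i))).
    apply: eq_bigr => s _; rewrite -big_distrr /=; congr (_ * _).
    under eq_bigr => i _ do rewrite mxE.
    rewrite bigA_distr_bigA /=; apply: eq_bigr => f _; apply: eq_bigr => i _.
    by rewrite mxE.
  rewrite exchange_big /=; apply: eq_bigr => f _.
  rewrite -det_tr /determinant big_distrr /=; apply: eq_bigr => s _.
  rewrite big_split /= mulrCA; congr (_ * (_ * _)).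
  by apply: eq_bigr => i _; rewrite !mxE.
have E2 (t : 'S_k) : \det (A *m A^T) = \sum_(f : {ffun 'I_k -> 'I_n})
    ((-1) ^+ t * \prod_i A i (f (t i))) * \det (colsub f A).
  pose th (u : 'S_k) (f : {ffun 'I_k -> 'I_n}) : {ffun 'I_k -> 'I_n} :=
    [ffun i => f (u i)].
  have th_bij : bijective (th t).
    exists (th t^-1%g) => f; apply/ffunP => i.
      by rewrite !ffunE permKV.
    by rewrite !ffunE permK.
  rewrite E1 (reindex (th t)) /=; last exact: onW_bij.
  apply: eq_bigr => f _.
  have -> : colsub (th t f) A = col_perm t (colsub f A).
    by apply/matrixP => i j; rewrite !mxE ffunE.
  rewrite col_permE det_mulmx det_perm odd_permV.
  rewrite [X in _ * X]mulrC mulrA [X in X * _]mulrC; congr (_ * _ * _).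
  by apply: eq_bigr => i _; rewrite ffunE.
rewrite mulr_natl -card_Sn -sumr_const.
under eq_bigr => t _ do rewrite (E2 t).
rewrite exchange_big /=; apply: eq_bigr => f _.
rewrite -mulr_suml expr2; congr (_ * _); apply: eq_bigr => t _.
by congr (_ * _); apply: eq_bigr => i _; rewrite mxE.
Qed.

(** Both sides are the determinant of the block matrix with rows [1, U] and
[-V, 1], eliminated from either end. *)
Lemma det1D_mulC (R : comPzRingType) n r (U : 'M[R]_(n, r)) (V : 'M[R]_(r, n)) :
  \det (1%:M + U *m V) = \det (1%:M + V *m U).
Proof.
have E1 : block_mx 1%:M U (- V) 1%:M =
    block_mx 1%:M 0 (- V) 1%:M *m block_mx 1%:M U 0 (1%:M + V *m U).
  rewrite mulmx_block ?(mul1mx, mulmx1, mul0mx, mulmx0) !addr0.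
  by rewrite mulNmx addrCA addNr addr0.
have E2 : block_mx 1%:M U (- V) 1%:M =
    block_mx 1%:M U 0 1%:M *m block_mx (1%:M + U *m V) 0 (- V) 1%:M.
  rewrite mulmx_block ?(mul1mx, mulmx1, mul0mx, mulmx0) !add0r.
  by rewrite mulmxN addrK.
have := congr1 determinant E1; rewrite E2 !det_mulmx.
by rewrite !det_lblock !det_ublock !det1 !mul1r !mulr1.
Qed.

(** Such an [M] is a perturbation of the identity of rank [r], so its determinant
is an [r * r] determinant by [det1D_mulC]. *)
Lemma det_replace_rows (R : comPzRingType) n r (V : 'M[R]_(r, n))
    (g : 'I_r -> 'I_n) (M : 'M[R]_n) : injective g ->
  (forall a, row (g a) M = row a V) ->
  (forall i, (forall a, g a != i) -> row i M = delta_mx 0 i) ->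
  \det M = \det (colsub g V).
Proof.
move=> g_inj Mg Mi.
pose U : 'M[R]_(n, r) := \matrix_(i, a) (i == g a)%:R.
pose W : 'M[R]_(r, n) := V - \matrix_(a, j) (j == g a)%:R.
have -> : M = 1%:M + U *m W.
  apply/row_matrixP => i; apply/rowP => j.
  rewrite [in RHS]mxE [(1%:M + U *m W) i j]mxE [(U *m W) i j]mxE [1%:M i j]mxE.
  case: (pickP (fun a => g a == i)) => [a /eqP <-|noi].
    rewrite Mg (bigD1 a) //= big1 => [|b ba].
      rewrite !mxE eqxx mul1r addr0 addrC eq_sym -addrA.
      by rewrite [X in V a j + X]addrC subrr addr0.
    by rewrite !mxE (inj_eq g_inj) eq_sym (negPf ba) mul0r.
  rewrite Mi => [|a]; last by rewrite noi.
  rewrite !mxE /= eq_sym big1 ?addr0// => a _.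
  by rewrite !mxE eq_sym noi mul0r.
rewrite det1D_mulC; congr (\det _); apply/matrixP => a b.
rewrite !mxE (bigD1 (g b)) //= big1 => [|j jb].
  rewrite !mxE eqxx mulr1 addr0 (inj_eq g_inj) eq_sym addrC -addrA.
  by rewrite [X in V _ _ + X]addrC subrr addr0.
by rewrite !mxE (negPf jb) mulr0.
Qed.

(** * Maximal transversals *)

(** If the rows of [Y] maximize the determinant over a product of families, then
in the coordinates given by [Y] no exchange of [r] rows can increase it. The
determinant after an exchange, divided by the one before, is the minor on the
left. *)
Lemma exchange_minor_le1 (R : realFieldType) n (I : finType)
    (G : 'I_n -> I -> 'rV[R]_n) (h : 'I_n -> I) (Y := \matrix_i G i (h i)) :
  \det Y != 0 ->
  (forall h' : 'I_n -> I, `|\det (\matrix_i G i (h' i))| <= `|\det Y|) ->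
  forall r (g : 'I_r -> 'I_n) (x : 'I_r -> I), injective g ->
  `|\det (\matrix_(a, b) (G (g a) (x a) *m invmx Y) 0 (g b))| <= 1.
Proof.
move=> Y0 Ymax r g x g_inj.
have Yu : Y \in unitmx by rewrite unitmxE unitfE.
pose h' i := if [pick a | g a == i] is Some a then x a else h i.
pose M := (\matrix_i G i (h' i)) *m invmx Y.
have Mg a : row (g a) M = G (g a) (x a) *m invmx Y.
  rewrite row_mul rowK /h'; case: pickP => [b /eqP/g_inj -> //|/(_ a)].
  by rewrite eqxx.
have Mi i : (forall a, g a != i) -> row i M = delta_mx 0 i.
  move=> gi; rewrite row_mul rowK /h'; case: pickP => [b|_].
    by rewrite (negPf (gi b)).
  by rewrite -(rowK (fun j => G j (h j)) i) -/Y -row_mul mulmxV// row1.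
have -> : \matrix_(a, b) (G (g a) (x a) *m invmx Y) 0 (g b) =
    colsub g (\matrix_(a, j) (G (g a) (x a) *m invmx Y) 0 j).
  by apply/matrixP => a b; rewrite !mxE.
rewrite -(@det_replace_rows _ _ _ _ g M)//; last first.
  by move=> a; rewrite Mg; apply/rowP => j; rewrite !mxE.
rewrite det_mulmx det_inv normrM normfV ler_pdivrMr ?normr_gt0// mul1r.
exact: Ymax.
Qed.

Lemma det_mx22 (R : comPzRingType) (A : 'M[R]_2) (i0 := ord0 : 'I_2)
    (i1 := lift ord0 ord0 : 'I_2) :
  \det A = A i0 i0 * A i1 i1 - A i0 i1 * A i1 i0.
Proof.
have e10 : lift i1 ord0 = i0 by apply: val_inj.
rewrite (expand_det_row _ i0) !big_ord_recl big_ord0 /cofactor !det_mx11 !mxE /=.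
rewrite -/i0 -/i1 e10 /bump /= !addn0 ?add0n expr0 expr1.
ring.
Qed.

Lemma det_mx33 (R : comPzRingType) (A : 'M[R]_3) (i0 := ord0 : 'I_3)
    (i1 := lift ord0 ord0 : 'I_3) (i2 := lift ord0 (lift ord0 ord0) : 'I_3) :
  \det A = A i0 i0 * A i1 i1 * A i2 i2 + A i0 i1 * A i1 i2 * A i2 i0
    + A i0 i2 * A i1 i0 * A i2 i1 - A i0 i0 * A i1 i2 * A i2 i1
    - A i0 i1 * A i1 i0 * A i2 i2 - A i0 i2 * A i1 i1 * A i2 i0.
Proof.
have e12 : lift i1 (lift ord0 ord0) = i2 by apply: val_inj.
have e10 : lift i1 ord0 = i0 by apply: val_inj.
have e20 : lift i2 ord0 = i0 by apply: val_inj.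
have e21 : lift i2 (lift ord0 ord0) = i1 by apply: val_inj.
rewrite (expand_det_row _ i0) !big_ord_recl big_ord0 /cofactor !det_mx22 !mxE /=.
rewrite -/i0 -/i1 -/i2 e12 e10 e20 e21 /bump /= !addn0 ?add0n expr0 expr1.
rewrite sqrrN expr1n.
ring.
Qed.

(** For [r = 1, 2, 3] the minors of [exchange_minor_le1] bound the products of
coordinates along cycles of length [r]. A minor of order 2 is a product of two
1-cycles minus a 2-cycle. A minor of order 3 contains both 3-cycles [u] and
[v] on the same indices, with equal signs; they cannot both be large because
[u * v] regroups into three 2-cycles. *)
Lemma cycle_bounds (R : realFieldType) n (I : Type) (c : 'I_n -> I -> 'I_n -> R) :
  (forall r (g : 'I_r -> 'I_n) (x : 'I_r -> I), injective g ->
    `|\det (\matrix_(a, b) c (g a) (x a) (g b))| <= 1) ->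
  [/\ forall a x, `|c a x a| <= 1,
      forall a b x y, a != b -> `|c a x b| * `|c b y a| <= 2 &
      forall a b d x y z, a != b -> b != d -> d != a ->
        `|c a x b| * `|c b y d| * `|c d z a| <= 9].
Proof.
move=> c1.
have C1 a x : `|c a x a| <= 1.
  have := c1 1 (fun=> a) (fun=> x); rewrite det_mx11 mxE; apply => i j _.
  by rewrite !ord1.
have C2 a b x y : a != b -> `|c a x b| * `|c b y a| <= 2.
  move=> ab; have := c1 2 (tnth [tuple a; b]) (tnth [tuple x; y]).
  rewrite det_mx22 !mxE /= -!normrM => {}c1.
  have := C1 a x; have := C1 b y => yb xa.
  have : `|c a x a * c b y b| <= 1.
    by rewrite normrM mulr_ile1.
  suff /c1 : injective (tnth [tuple a; b]).
    rewrite !ler_norml.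
    change (tnth [tuple a; b] _) with a; change (tnth [tuple a; b] _) with b.
    by rewrite /tnth /=; lra.
  by apply/tuple_uniqP; rewrite /= mem_seq1 andbT.
split=> // a b d x y z ab bd da.
have := c1 3 (tnth [tuple a; b; d]) (tnth [tuple x; y; z]).
rewrite det_mx33 !mxE /tnth /= => {}c1.
have inj : injective (tnth [tuple a; b; d]).
  by apply/tuple_uniqP; rewrite /= !inE !andbT negb_or ab eq_sym da.
have {c1 inj} := c1 inj.
set u := c a x b * c b y d * c d z a; set v := c a x d * c b y a * c d z b.
set t0 := c a x a * c b y b * c d z d.
set t1 := c a x a * c b y d * c d z b.
set t2 := c a x b * c b y a * c d z d.
set t3 := c a x d * c b y b * c d z a.
have m1 r s : `|r| <= 1 -> `|s| <= 2 -> `|r * s| <= 2 :> R.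
  by move=> r1 s2; rewrite normrM -[leRHS]mul1r ler_pM.
have {}C2 p q x' y' : p != q -> `|c p x' q * c q y' p| <= 2.
  by move=> pq; rewrite normrM C2.
have H0 : `|t0| <= 1 by rewrite !normrM !mulr_ile1 ?mulr_ge0.
have H1 : `|t1| <= 2 by rewrite /t1 -mulrA m1 ?C2.
have H2 : `|t2| <= 2 by rewrite /t2 mulrC m1 ?C2.
have H3 : `|t3| <= 2.
  by rewrite /t3 mulrC mulrA mulrC m1 // C2.
have Huv : `|u| * `|v| <= 8.
  (* The six factors regroup into the 2-cycles on each pair of indices. *)
  have -> : `|u| * `|v| = (`|c a x b * c b y a| * `|c b y d * c d z b|)
      * `|c d z a * c a x d|.
    by rewrite -!normrM; congr (`|_|); rewrite /u /v; ring.
  have -> : 8 = 2 * 2 * 2 :> R by lra.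
  by rewrite !ler_pM ?mulr_ge0// C2.
rewrite -!normrM -/u => H.
have {H H0 H1 H2 H3} : `|u| <= `|v| + 8.
  have := lexx `|v|; move: H H0 H1 H2 H3; rewrite !ler_norml.
  move=> /andP[? ?] /andP[? ?] /andP[? ?] /andP[? ?] /andP[? ?] /andP[? ?].
  by apply/andP; split; lra.
have := normr_ge0 u; have := normr_ge0 v; nra.
Qed.

(** A greedy choice: the first [j] vectors span at most [j] dimensions, so some
member of the next family lies outside their span. *)
Lemma exists_transversal (K : fieldType) n (I : Type) (x0 : I)
    (G : 'I_n -> I -> 'rV[K]_n) :
  (forall j : 'I_n, exists m (B : 'M[K]_(m, n)),
    (j < \rank B)%N /\ forall i, exists x, row i B = G j x) ->
  exists h : 'I_n -> I, \det (\matrix_i G i (h i)) != 0.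
Proof.
move=> GB.
suff [h hn] : exists h : 'I_n -> I,
    \rank (\sum_(i < n | (i < n)%N) <<G i (h i)>>)%MS = n.
  exists h; rewrite -unitfE -[_ \is a _]unitmxE -row_full_unit /row_full.
  rewrite eqn_leq rank_leq_col /= -{1}hn mxrankS//.
  apply/sumsmx_subP => i _; rewrite genmxE.
  by rewrite -(rowK (fun i => G i (h i)) i) row_sub.
suff : forall m, (m <= n)%N -> exists h : 'I_n -> I,
    \rank (\sum_(i < n | (i < m)%N) <<G i (h i)>>)%MS = m by apply.
elim=> [_|m IHm mn]; first by exists (fun=> x0); rewrite big_pred0// mxrank0.
have [h hm] := IHm (ltnW mn); pose j := Ordinal mn.
set V := (X in \rank X) in hm.
have [m' [B [jB BG]]] := GB j.
have [x xV] : exists x, ~~ (G j x <= V)%MS.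
  have /row_subPn[i Bi] : ~~ (B <= V)%MS.
    by apply: contraL jB => /mxrankS; rewrite hm -leqNgt.
  by have [x Bx] := BG i; exists x; rewrite -Bx.
exists (fun i => if i == j then x else h i).
rewrite (bigD1 j) /=; last by rewrite ltnS.
rewrite eqxx.
have -> : (\sum_(i < n | (i < m.+1)%N && (i != j))
    <<G i (if i == j then x else h i)>>)%MS = V.
  apply: eq_big => [i|i /andP[_ /negPf->]//].
  by rewrite ltnS [in RHS]ssrnat.ltn_neqAle andbC.
apply/eqP; rewrite eqn_leq; apply/andP; split.
  rewrite (leq_trans (mxrank_adds_leqif _ _))// hm mxrank_gen.
  by rewrite -(add1n m) leq_add2r rank_leq_row.
rewrite -[m in (m < _)%N]hm ltnNge; apply: contra xV => rV.
have /eqmxP/eqmx_sym VE : (V == <<G j x>> + V)%MS.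
  by rewrite -(geq_leqif (mxrank_leqif_eq (addsmxSr _ _))).
by rewrite -VE (submx_trans _ (addsmxSl _ _))// genmxE.
Qed.

Lemma exists_complement k m n (f : 'I_k -> 'I_n) : n = (k + m)%N ->
  injective f ->
  exists2 t : 'I_m -> 'I_n, injective t & forall i j, f i != t j.
Proof.
move=> nE f_inj; pose A : {set 'I_n} := (~: (f @: 'I_k))%SET.
have cA : m = #|A|.
  by rewrite cardsCs finset.setCK card_ord card_imset// card_ord nE addKn.
exists (fun j => enum_val (cast_ord cA j)).
  by move=> i j /enum_val_inj/cast_ord_inj.
move=> i j; have := enum_valP (cast_ord cA j); rewrite !inE.
by apply: contra => /eqP <-; rewrite imset_f.
Qed.

(** After a permutation of the columns the completed matrix is block triangular,
with an identity block. *)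
Lemma norm_det_col_mx_delta (R : realDomainType) k m (Z : 'M[R]_(k, k + m))
    (f : 'I_k -> 'I_(k + m)) (t : 'I_m -> 'I_(k + m)) :
  injective f -> injective t -> (forall i j, f i != t j) ->
  `|\det (col_mx Z (\matrix_j delta_mx 0 (t j)))| = `|\det (colsub f Z)|.
Proof.
move=> f_inj t_inj ft.
pose s0 i := match fintype.split i with inl a => f a | inr b => t b end.
have s0_inj : injective s0.
  move=> i j; rewrite /s0.
  case: splitP => a ia; case: splitP => b jb.
  - by move/f_inj => ab; apply: val_inj; rewrite /= ia jb ab.
  - by move=> E; have := ft a b; rewrite E eqxx.
  - by move=> E; have := ft b a; rewrite E eqxx.
  - by move/t_inj => ab; apply: val_inj; rewrite /= ia jb ab.
pose s := perm s0_inj.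
have := congr1 (fun A => `|\det A|)
  (col_permE s (col_mx Z (\matrix_j delta_mx 0 (t j)))).
rewrite det_mulmx det_perm normrM normrX normrN1 expr1n mulr1 => <-.
have -> : col_perm s (col_mx Z (\matrix_j delta_mx 0 (t j))) =
    block_mx (colsub f Z) (colsub t Z) 0 1%:M.
  have sl b : fintype.split (lshift m b) = inl b := unsplitK (inl b).
  have sr b : fintype.split (rshift k b) = inr b := unsplitK (inr b).
  apply/matrixP => i j.
  rewrite -[i]splitK -[j]splitK !mxE permE /s0 !unsplitK.
  case: (fintype.split i) => a; case: (fintype.split j) => b //=;
    rewrite !mxE ?sl ?sr ?mxE //=.
    by rewrite (negPf (ft _ _)).
  by rewrite (inj_eq t_inj) eq_sym.
by rewrite det_ublock det1 mulr1.
Qed.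

Lemma det_colsub_ninj (R : comPzRingType) k n (A : 'M[R]_(k, n))
    (f : 'I_k -> 'I_n) : ~ injective f -> \det (colsub f A) = 0.
Proof.
move=> /injectiveP/injectivePn[i [j ij fij]].
rewrite -det_tr; apply: (determinant_alternate ij) => l.
by rewrite !mxE fij.
Qed.

Lemma det_eq_rows (R : comPzRingType) n (A : 'M[R]_n) i j :
  i != j -> row i A = row j A -> \det A = 0.
Proof.
move=> ij Aij; apply: (determinant_alternate ij) => l.
by have /rowP/(_ l) := Aij; rewrite !mxE.
Qed.

Lemma norm_det_col_mx_delta_le (R : realDomainType) k m (Z : 'M[R]_(k, k + m)) s
    (t : 'I_m -> 'I_(k + m)) :
  0 <= s -> (forall f : 'I_k -> 'I_(k + m), `|\det (colsub f Z)| <= s) ->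
  `|\det (col_mx Z (\matrix_j delta_mx 0 (t j)))| <= s.
Proof.
move=> s0 Zs; have [/injectiveP t_inj|/injectivePn[i [j ij tij]]] := 
  boolP (injectiveb t).
  have [f f_inj ft] := exists_complement (addnC k m) t_inj.
  by rewrite (@norm_det_col_mx_delta _ _ _ _ f)// => a b; rewrite eq_sym.
rewrite (@det_eq_rows _ _ _ (rshift k i) (rshift k j)) ?normr0//.
  by rewrite (inj_eq (@rshift_inj _ _)).
by rewrite !rowKd !rowK tij.
Qed.

Lemma bigmax_mul_le (R : realFieldType) (I : finType) (F : I -> R) (y B : R) :
  0 <= B -> (forall i, F i * y <= B) ->
  (\big[Num.max/0]_i F i) * y <= B.
Proof.
move=> B0 FB; elim/big_ind: _ => [|a b aB bB|i _]; first by rewrite mul0r.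
  by rewrite /Num.max; case: ifP.
exact: FB.
Qed.

(** * Mixed minors *)

(** As many columns cross from the right block to the left as from the left to
the right. *)
Lemma card_crossing k m (u : {perm 'I_(k + m)}) :
  (\sum_(i < m) (u (rshift k i) < k) = \sum_(l < k) ~~ (u (lshift m l) < k))%N.
Proof.
have : (\sum_(x < k + m) (u x < k) = \sum_(x < k + m) (x < k))%N.
  by rewrite [RHS](reindex_inj (@perm_inj _ u)).
rewrite !big_split_ord /= [X in (_ = _ + X)%N]big1 => [|i _]; last first.
  by rewrite ltnNge leq_addr.
rewrite addn0 => E; apply/eqP.
rewrite -(eqn_add2l (\sum_(l < k) (u (lshift m l) < k))) E -big_split /=.
by apply/eqP/eq_bigr => l _; rewrite ltn_ord; case: (_ < k)%N.
Qed.

(** In each term of the Leibniz formula the upper right and lower left blocks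
are used equally often ([card_crossing]), so every factor [r] can be moved to a
left column, where it meets a factor [b l]. *)
Lemma norm_det_block_le (R : realFieldType) k m (A : 'M[R]_(k + m))
    (w b : 'I_k -> R) (r : R) : 0 <= r ->
  (forall i l, `|A (lshift m i) (lshift m l)| <= w l) ->
  (forall i l, `|A (lshift m i) (rshift k l)| <= r) ->
  (forall i l, `|A (rshift k i) (lshift m l)| <= b l) ->
  (forall i l, `|A (rshift k i) (rshift k l)| <= 1) ->
  `|\det A| <= (k + m)`!%:R * \prod_l Num.max (w l) (r * b l).
Proof.
move=> r0 Aul Aur Adl Adr; apply: norm_det_le_perm => s; set u := (s^-1)%g.
have split_left (i : 'I_(k + m)) : (i < k)%N -> exists j : 'I_k, i = lshift m j.
  by move=> ik; exists (Ordinal ik); apply: val_inj.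
have split_right (i : 'I_(k + m)) : ~~ (i < k)%N -> exists j : 'I_m, i = rshift k j.
  rewrite -leqNgt => ik; have im : (i - k < m)%N by rewrite ltn_subLR.
  by exists (Ordinal im); apply: val_inj; rewrite /= subnKC.
rewrite big_split_ord /=.
have : \prod_(i < m) `|A (u (rshift k i)) (rshift k i)| <=
    r ^+ \sum_(i < m) (u (rshift k i) < k)%N.
  rewrite expr_sum; apply: ler_prod => i _; rewrite normr_ge0 /=.
  case: (boolP (_ < k)%N) => [/split_left[j ->]|/split_right[j ->]] /=.
    by rewrite expr1.
  by rewrite expr0.
rewrite card_crossing expr_sum => H.
apply: le_trans (ler_wpM2l _ H) _; first exact: prodr_ge0.
rewrite -big_split /=; apply: ler_prod => l _.
rewrite mulr_ge0 ?exprn_ge0//= le_max.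
case: (boolP (_ < k)%N) => [/split_left[j ->]|/split_right[j ->]] /=.
  by rewrite expr0 mulr1 Aul.
by rewrite expr1 mulrC ler_wpM2l ?orbT.
Qed.

Section mixed.
Context (R : realFieldType) (k m : nat) (v : 'I_k -> 'I_k -> 'rV[R]_(k + m)).

Let I := ('I_k * 'I_(k + m))%type.

(** For [k < n] the exchange argument needs square determinants. The [k] given
families are completed by [m] copies of the family of all unit vectors; a
determinant of the completed system is then a [k]-minor up to sign. A pair
serves as common index type: its first component indexes a given family, its
second one a unit vector. *)
Definition padded (j : 'I_(k + m)) (p : I) : 'rV[R]_(k + m) :=
  match fintype.split j with inl a => v a p.1 | inr _ => delta_mx 0 p.2 end.

Lemma padded_lshift a p : padded (lshift m a) p = v a p.1.
Proof. by rewrite /padded (unsplitK (inl a)). Qed.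

Lemma padded_rshift a p : padded (rshift k a) p = delta_mx 0 p.2.
Proof. by rewrite /padded (unsplitK (inr a)). Qed.

Lemma padded_col_mx (h : 'I_(k + m) -> I) :
  \matrix_j padded j (h j) = col_mx (\matrix_j v j (h (lshift m j)).1)
    (\matrix_j delta_mx 0 (h (rshift k j)).2).
Proof.
apply/row_matrixP => i; rewrite rowK.
by case: (split_ordP i) => j ->;
  rewrite ?(rowKu, rowKd) rowK ?(padded_lshift, padded_rshift).
Qed.

Lemma exists_padded_basis : (0 < k)%N ->
  (forall j, exists f : 'I_k -> 'I_(k + m),
    \det (colsub f (\matrix_i v j i)) != 0) ->
  exists h : 'I_(k + m) -> I, \det (\matrix_j padded j (h j)) != 0.
Proof.
move=> k0 vf.
have i0 : 'I_(k + m) by exists 0%N; rewrite ltn_addr.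
apply: (exists_transversal (Ordinal k0, i0)) => j.
case: (split_ordP j) => a ->.
  have [f f0] := vf a.
  exists k, (\matrix_i v a i); split.
    apply: (@leq_trans k); first by rewrite /= ltn_ord.
    have fE : colsub f (\matrix_i v a i) = (\matrix_i v a i) *m colsub f 1%:M.
      by rewrite mulmx_colsub mulmx1.
    move: f0; rewrite -unitfE -[_ \is a _]unitmxE -row_full_unit => /eqP.
    by rewrite fE => {1}<-; exact: mxrankM_maxl.
  by move=> i; exists (i, i0); rewrite rowK padded_lshift.
exists (k + m)%N, 1%:M; rewrite mxrank1; split; first exact: ltn_ord.
by move=> i; exists (Ordinal k0, i); rewrite row1 padded_rshift.
Qed.

(** Choose a transversal [Y] of the padded families with maximal determinant and
express all vectors in the basis [Y]. Let [M a l] bound the [l]-th coordinate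
on the family [a]. Then [cycle_bounds] controls products of the [M a l] along
short cycles. The coordinates on the added unit vectors are absorbed in
[N j l], which collects the direct bound [M j l] and the contributions that
pass through an added row; [norm_det_block_le] bounds the minor of the family
[j] by the product of the [N j l] over [l]. The product over all pairs [j, l]
is controlled because [N j l * N l j <= 9]. *)
Lemma mixed_minors (s : R) :
  (0 < k)%N ->
  (forall (h : 'I_k -> 'I_k) (f : 'I_k -> 'I_(k + m)),
    `|\det (colsub f (\matrix_j v j (h j)))| <= s) ->
  forall f : 'I_k -> 'I_k -> 'I_(k + m),
  \prod_j `|\det (colsub (f j) (\matrix_i v j i))| <=
    ((k + m)`!%:R * 3 ^+ k * s) ^+ k.
Proof.
move=> k0 vs f.
have s0 : 0 <= s by apply: le_trans (vs id (lshift m)).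
have C0 : 0 <= (k + m)`!%:R * 3 ^+ k * s by rewrite !mulr_ge0 ?exprn_ge0.
have [/forallP/= f0|] :=
  boolP [forall j, \det (colsub (f j) (\matrix_i v j i)) != 0];
  last first.
  rewrite negb_forall => /existsP[j]; rewrite negbK => /eqP fj0.
  by rewrite (bigD1 j)//= fj0 normr0 mul0r exprn_ge0.
have f_inj j : injective (f j).
  have [/injectiveP//|/injectiveP fj] := boolP (injectiveb (f j)).
  by have := f0 j; rewrite det_colsub_ninj ?eqxx.
have [h0 Gh0] := exists_padded_basis k0 (fun j => ex_intro _ (f j) (f0 j)).
pose D (h : {ffun 'I_(k + m) -> I}) := `|\det (\matrix_j padded j (h j))|.
have [h _ hmax] := @arg_maxP _ R _ (finfun h0) xpredT D isT.
have DE (h' : 'I_(k + m) -> I) :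
    D (finfun h') = `|\det (\matrix_j padded j (h' j))|.
  by congr (`|\det _|); apply/row_matrixP => j; rewrite !rowK ffunE.
set Y := \matrix_j padded j (h j).
have Y0 : \det Y != 0.
  have := hmax (finfun h0) isT; rewrite DE /D -/Y -normr_gt0; apply: lt_le_trans.
  by rewrite normr_gt0.
have Ymax h' : `|\det (\matrix_j padded j (h' j))| <= `|\det Y|.
  by have := hmax (finfun h') isT; rewrite DE.
have Ys : `|\det Y| <= s.
  rewrite /Y padded_col_mx; exact: norm_det_col_mx_delta_le.
have Yu : Y \in unitmx by rewrite unitmxE unitfE.
pose c j p l : R := (padded j p *m invmx Y) 0 l.
have [c1 c2 c3] := cycle_bounds (@exchange_minor_le1 _ _ _ _ h Y0 Ymax : 
  forall r (g : 'I_r -> 'I_(k + m)) x, _ -> 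
   `|\det (\matrix_(a, b) c (g a) (x a) (g b))| <= 1).
pose M (a l : 'I_(k + m)) : R := \big[Num.max/0]_p `|c a p l|.
have M0 a l : 0 <= M a l by apply: bigmax_ge_id.
have cM a p l : `|c a p l| <= M a l by exact: le_bigmax.
have M1 a : M a a <= 1.
  by rewrite -[leLHS]mulr1; apply: bigmax_mul_le => // p; rewrite mulr1 c1.
have M2 a b : a != b -> M a b * M b a <= 2.
  move=> ab; apply: bigmax_mul_le => // p; rewrite mulrC.
  by apply: bigmax_mul_le => // q; rewrite mulrC c2.
have M3 a b d : a != b -> b != d -> d != a -> M a b * M b d * M d a <= 9.
  move=> ab bd da; rewrite -mulrA; apply: bigmax_mul_le => // p.
  rewrite mulrCA; apply: bigmax_mul_le => // q.
  rewrite mulrA mulrC; apply: bigmax_mul_le => // q'.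
  by rewrite mulrC [X in X * _]mulrC c3.
(* [r] bounds the coordinates of a given family along the added rows, [b] the
   coordinates of the unit vectors. *)
pose r j : R := \big[Num.max/0]_(i < m) M (lshift m j) (rshift k i).
pose b l : R := \big[Num.max/0]_(t < k + m)
  `|((delta_mx 0 t : 'rV[R]_(k + m)) *m invmx Y) 0 l|.
have r0 j : 0 <= r j by apply: bigmax_ge_id.
have b0 l : 0 <= b l by apply: bigmax_ge_id.
have bM i l : b l <= M (rshift k i) l.
  rewrite -[leLHS]mulr1; apply: bigmax_mul_le => // t; rewrite mulr1.
  by rewrite -(padded_rshift i (Ordinal k0, t)) cM.
have rb j : r j * b (lshift m j) <= 2.
  apply: bigmax_mul_le => // i; apply: le_trans (ler_wpM2l _ (bM i _)) _ => //.
  by rewrite M2 // eq_lrshift.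
pose N j l := Num.max (M (lshift m j) (lshift m l)) (r j * b (lshift m l)).
(* For [j != l] this is a 3-cycle through an added row. *)
have Mrb j l : M (lshift m j) (lshift m l) * (r l * b (lshift m j)) <= 9.
  have [->|jl] := eqVneq j l.
    have -> : 9 = 9 * 1 :> R by rewrite mulr1.
    rewrite mulrC ler_pM ?mulr_ge0//; apply: le_trans (rb l) _; lra.
  rewrite mulrCA; apply: bigmax_mul_le => // i.
  apply: le_trans (_ : M (lshift m j) (lshift m l) * M (lshift m l) (rshift k i)
    * M (rshift k i) (lshift m j) <= _); last first.
    by rewrite M3 ?eq_lrshift ?eq_rlshift// (inj_eq (@lshift_inj _ _)).
  by rewrite mulrA [X in X * _]mulrC ler_wpM2l ?mulr_ge0.
have N0 j l : 0 <= N j l by rewrite le_max M0.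
have NN j l : N j l * N l j <= 9.
  rewrite {1}/N {1}/Num.max; case: ifP => _; rewrite /N /Num.max; case: ifP => _.
  - have -> : r j * b (lshift m l) * (r l * b (lshift m j)) =
        (r j * b (lshift m j)) * (r l * b (lshift m l)) by ring.
    apply: le_trans (ler_pM _ _ (rb j) (rb l)) _; rewrite ?mulr_ge0//; lra.
  - by rewrite mulrC; exact: Mrb.
  - exact: Mrb.
  - have [->|jl] := eqVneq j l.
      by apply: le_trans (mulr_ile1 _ _ _ _) _; rewrite ?M0 ?M1//; lra.
    by apply: le_trans (M2 _ _ _) _; rewrite ?(inj_eq (@lshift_inj _ _))//; lra.
(* Squaring pairs the entry [j, l] with [l, j], the diagonal included. *)
have PN : \prod_j \prod_l N j l <= 3 ^+ k ^+ k.
  rewrite -(@ler_pXn2r _ 2)// ?nnegrE ?exprn_ge0//; last first.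
    by apply: prodr_ge0 => j _; apply: prodr_ge0.
  rewrite expr2 {2}exchange_big /= -big_split /=.
  have -> : (3 ^+ k ^+ k) ^+ 2 = \prod_(j < k) \prod_(l < k) 9 :> R.
    have -> : 9 = 3 ^+ 2 :> R by rewrite expr2 -natrM.
    by rewrite !prodr_const !card_ord -!exprM; congr (_ ^+ _); lia.
  apply: ler_prod => j _; rewrite -big_split /=; apply/andP; split.
    by apply: prodr_ge0 => l _; rewrite mulr_ge0.
  by apply: ler_prod => l _; rewrite mulr_ge0// NN.
apply: le_trans (_ : \prod_j ((k + m)`!%:R * (\prod_l N j l) * s) <= _).
  apply: ler_prod => j _; rewrite normr_ge0 /=.
  have [t t_inj ft] := exists_complement (erefl _) (@f_inj j).
  rewrite -(norm_det_col_mx_delta _ (@f_inj j) t_inj ft).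
  set X := col_mx _ _.
  have -> : X = X *m invmx Y *m Y by rewrite mulmxKV.
  rewrite det_mulmx normrM; apply: ler_pM => //.
  have XE i l : (X *m invmx Y) i l = (row i X *m invmx Y) 0 l.
    by rewrite -row_mul [RHS]mxE.
  have Xu i l : (X *m invmx Y) (lshift m i) l = c (lshift m j) (i, lshift m j) l.
    by rewrite XE rowKu rowK /c padded_lshift.
  have Xd i l : (X *m invmx Y) (rshift k i) l =
      ((delta_mx 0 (t i) : 'rV[R]_(k + m)) *m invmx Y) 0 l.
    by rewrite XE rowKd rowK.
  apply: norm_det_block_le => // i l; rewrite ?Xu ?Xd ?cM//.
  - apply: le_trans (cM _ _ _) _.
    exact: (le_bigmax _ (fun l => M (lshift m j) (rshift k l))).
  - exact: (le_bigmax _ (fun t => `|((delta_mx 0 t : 'rV[R]_(k + m)) *m invmx Y) 0 _|)).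
  - by rewrite -(padded_rshift l (Ordinal k0, t i)); exact: c1.
rewrite !big_split /= !prodr_const !card_ord !exprMn ler_wpM2r ?exprn_ge0//.
by rewrite ler_wpM2l ?exprn_ge0.
Qed.

End mixed.

(** * Inner products and Gram determinants *)

Section inner_product.
Context (R : realType) (H : finHilbertType R).
Implicit Types x y z : H.
Local Notation n := (\dim {:H}).

Lemma innerC x y : inner x y = inner y x.
Proof. by rewrite (hermC inner) expr0 mul1r. Qed.

Lemma innerZl a x z : inner (a *: x) z = a * inner x z.
Proof. by rewrite linearZl. Qed.

Lemma innerZr a x z : inner z (a *: x) = a * inner z x.
Proof. by rewrite innerC innerZl innerC. Qed.

Lemma inner_ge0 x : 0 <= inner x x.
Proof.
have [->|x0] := eqVneq x 0; first by rewrite linear0l.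
exact/ltW/(neq0_dnorm_gt0 (s := inner)).
Qed.

Lemma innerxx x : inner x x = `|x| ^+ 2.
Proof. by rewrite inner_norm sqr_sqrtr// inner_ge0. Qed.

(** Cauchy-Schwarz, from the nonnegativity of the square norm of
[|y|^2 x - <x, y> y]. *)
Lemma norm_inner_le x y : `|inner x y| <= `|x| * `|y|.
Proof.
have [->|y0] := eqVneq y 0; first by rewrite linear0r normr0 mulr_ge0.
have y2 : 0 < `|y| ^+ 2 by rewrite exprn_gt0// normr_gt0.
have := inner_ge0 (`|y| ^+ 2 *: x - inner x y *: y).
rewrite linearBl !linearBr/= !(innerZl, innerZr) (innerC y x) !innerxx => h.
rewrite -(@ler_pXn2r _ 2)// ?nnegrE ?mulr_ge0// exprMn real_normK ?num_real//.
rewrite -(ler_pM2l y2); nra.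
Qed.

Lemma orthonormal_nth (s : seq H) i j : orthonormal inner s ->
  (i < size s)%N -> (j < size s)%N -> inner s`_i s`_j = (i == j)%:R.
Proof.
elim: s i j => [|u s IHs] i j //=.
rewrite /orthonormal /= andbT => /andP[/andP[/eqP uu s1] /andP[us ss]].
have {}IHs := IHs _ _ (introT andP (conj s1 ss)).
have us0 a : (a < size s)%N -> inner u s`_a = 0.
  by move=> sa; move: us => /allP/(_ s`_a (mem_nth 0 sa))/eqP.
case: i j => [|i] [|j] //=; rewrite !ltnS => si sj.
- exact: us0.
- by rewrite innerC us0.
- by rewrite IHs.
Qed.

Section basis.
Variable w : n.-tuple H.
Hypothesis w_basis : orthonormal_basis w.

Lemma orthonormal_tnth i j : inner (tnth w i) (tnth w j) = (i == j)%:R.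
Proof.
have /andP[_ wo] := w_basis.
by rewrite !(tnth_nth 0) orthonormal_nth// size_tuple.
Qed.

Lemma orthonormal_sum x : x = \sum_i inner x (tnth w i) *: tnth w i.
Proof.
have /andP[/andP[/eqP wT _] _] := w_basis.
have xw : x \in <<w>>%VS by rewrite wT memvf.
rewrite {1}(coord_span xw); apply: eq_bigr => i _.
rewrite -tnth_nth; congr (_ *: _).
rewrite [in RHS](coord_span xw) linear_sumlz (bigD1 i)//= big1 => [|j ji].
  by rewrite -tnth_nth innerZl orthonormal_tnth eqxx mulr1 addr0.
by rewrite -tnth_nth innerZl orthonormal_tnth (negPf ji) mulr0.
Qed.

Lemma parseval x y : inner x y = \sum_i inner x (tnth w i) * inner y (tnth w i).
Proof.
rewrite [in LHS](orthonormal_sum x) linear_sumlz; apply: eq_bigr => i _.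
by rewrite [LHS]innerZl (innerC y).
Qed.

End basis.

Section gram.
Variable k : nat.
Implicit Type v : 'I_k -> H.

Definition gram v : R := \det (\matrix_(i, j) inner (v i) (v j)).

Definition basis_minor (w : n.-tuple H) v (f : 'I_k -> 'I_n) : R :=
  \det (\matrix_(i, j) inner (v i) (tnth w (f j))).

Variable w : n.-tuple H.
Hypothesis w_basis : orthonormal_basis w.

(** Cauchy-Binet in an orthonormal basis: the Gram determinant is comparable
with the largest coordinate minor, whichever orthonormal basis is used. *)
Lemma gram_basis_minor v : (k`!)%:R * gram v =
  \sum_(f : {ffun 'I_k -> 'I_n}) basis_minor w v f ^+ 2.
Proof.
pose A : 'M[R]_(k, n) := \matrix_(i, j) inner (v i) (tnth w j).
have -> : gram v = \det (A *m A^T).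
  congr (\det _); apply/matrixP => i j; rewrite !mxE (parseval w_basis).
  by apply: eq_bigr => l _; rewrite !mxE.
rewrite cauchy_binet; apply: eq_bigr => f _; congr (\det _ ^+ 2).
by apply/matrixP => i j; rewrite !mxE.
Qed.

Lemma basis_minorE v f : basis_minor w v f =
  \det (colsub f (\matrix_i (\row_j inner (v i) (tnth w j)))).
Proof. by congr (\det _); apply/matrixP => i j; rewrite !mxE. Qed.

Let kfact_ge1 : 1 <= (k`!)%:R :> R.
Proof. by rewrite ler1n fact_gt0. Qed.

Lemma gram_basis_ge0 v : 0 <= gram v.
Proof.
rewrite -(pmulr_rge0 (gram v) (lt_le_trans ltr01 kfact_ge1)) gram_basis_minor.
by apply: sumr_ge0 => f _; rewrite sqr_ge0.
Qed.

Lemma basis_minor_le_gram v (f : 'I_k -> 'I_n) :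
  basis_minor w v f ^+ 2 <= (k`!)%:R * gram v.
Proof.
rewrite gram_basis_minor (bigD1 (finfun f))//= -[leLHS]addr0 lerD//.
  rewrite le_eqVlt; apply/orP; left; apply/eqP; congr (\det _ ^+ 2).
  by apply/matrixP => i j; rewrite !mxE ffunE.
by apply: sumr_ge0 => g _; rewrite sqr_ge0.
Qed.

Lemma gram_le_basis_minor v (s : R) :
  (forall f, `|basis_minor w v f| <= s) -> gram v <= (n ^ k)%:R * s ^+ 2.
Proof.
move=> vs; apply: (@le_trans _ _ ((k`!)%:R * gram v)).
  by rewrite ler_peMl// gram_basis_ge0.
rewrite gram_basis_minor mulr_natl.
have -> : (n ^ k)%N = #|{ffun 'I_k -> 'I_n}| by rewrite card_ffun !card_ord.
rewrite -sumr_const; apply: ler_sum => f _.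
by rewrite -real_normK ?num_real// lerXn2r ?nnegrE// (le_trans _ (vs f)).
Qed.

End gram.

End inner_product.

(** * Greedy orthonormal bases *)

Section orthonormalization.
Context (R : realType) (H : finHilbertType R).
Implicit Types x y z u : H.
Implicit Type q : seq H.
Local Notation n := (\dim {:H}).

Definition residual q x := x - \sum_(p <- q) inner x p *: p.

Lemma inner_span_eq0 q u y : (forall p, p \in q -> inner p u = 0) ->
  y \in <<q>>%VS -> inner y u = 0.
Proof.
move=> qu yq; rewrite (coord_span (yq : y \in <<in_tuple q>>%VS)) linear_sumlz big1// => i _.
by rewrite [LHS]innerZl qu ?mulr0// mem_nth//.
Qed.

Lemma sub_residual_span q x : x - residual q x \in <<q>>%VS.
Proof.
rewrite /residual opprB addrC subrK big_seq; apply: rpred_sum => p pq.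
by rewrite rpredZ// memv_span.
Qed.

Lemma residual_orthogonal q x p : orthonormal inner q -> p \in q ->
  inner p (residual q x) = 0.
Proof.
move=> qo /(nthP 0)[i iq <-]; rewrite innerC.
rewrite linearBl /= linear_sumlz (big_nth 0) big_mkord (bigD1 (Ordinal iq))//=.
rewrite innerZl orthonormal_nth// eqxx mulr1 big1 ?addr0 ?subrr// => j ji.
by rewrite innerZl orthonormal_nth// -[_ == i]/(j == Ordinal iq) (negPf ji) mulr0.
Qed.

Lemma inner_residual q x u : (forall p, p \in q -> inner p u = 0) ->
  inner (residual q x) u = inner x u.
Proof.
move=> qu; have := inner_span_eq0 qu (sub_residual_span q x).
by rewrite linearBl/= => /eqP; rewrite subr_eq0 => /eqP ->.
Qed.

Lemma norm_residual_le q x : orthonormal inner q -> `|residual q x| <= `|x|.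
Proof.
move=> qo; have [->|r0] := eqVneq (residual q x) 0; first by rewrite normr0.
have r1 : 0 < `|residual q x| by rewrite normr_gt0.
rewrite -(ler_pM2r r1) -expr2 -innerxx inner_residual.
  exact: le_trans (ler_norm _) (norm_inner_le _ _).
by move=> p; exact: residual_orthogonal.
Qed.

Lemma exists_half_max (T : Type) (F : set T) (d : T -> R) (N : R) :
  F !=set0 -> (forall x : T, 0 <= d x) -> (forall x : T, F x -> d x <= N) ->
  exists2 z : T, F z & forall x : T, F x -> d x <= 2 * d z.
Proof.
move=> [x0 Fx0] d0 dN.
have supF : has_sup (d @` F).
  by split; [exists (d x0), x0|exists N => _ [x Fx <-]; exact: dN].
have [s0|s0] := leP (sup (d @` F)) 0.
  exists x0 => // x Fx; rewrite (@le_trans _ _ 0) ?mulr_ge0//.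
  by apply: le_trans s0; apply: ub_le_sup; [case: supF|exists x].
have [_ [z Fz <-] zs] := sup_adherent (divr_gt0 s0 (ltr0n _ 2)) supF.
exists z => // x Fx; have : d x <= sup (d @` F).
  by apply: ub_le_sup; [case: supF|exists x].
lra.
Qed.

(** The frame is built by adding at each step a point of [F] whose distance to
the span of the previous directions is at least half of the largest possible
one; its normalized residual is the new direction. When [F] is contained in
that span, the new direction is any unit vector orthogonal to it. The most
recent pair comes first in the list, so the recorded point of an entry is
orthogonal to the directions of the entries before it. *)
Lemma greedy_frame (F : set H) (N : R) : F !=set0 ->
  (forall x, F x -> `|x| <= N) ->
  exists s : seq (H * H), [/\ size s = n, orthonormal inner (unzip1 s),
    free (unzip1 s),
    pairwise (fun p p' => inner p'.2 p.1 == 0) s &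
    forall p, p \in s ->
      F p.2 /\ forall x, F x -> `|inner x p.1| <= 2 * `|inner p.2 p.1| ].
Proof.
move=> F0 FN.
suff : forall m, (m <= n)%N -> exists s : seq (H * H),
    [/\ size s = m, orthonormal inner (unzip1 s), free (unzip1 s),
    pairwise (fun p p' => inner p'.2 p.1 == 0) s &
    forall p, p \in s -> p.2 \in <<unzip1 s>>%VS /\ (F p.2 /\
       forall x, F x -> `|inner x p.1| <= 2 * `|inner p.2 p.1|)].
  move=> /(_ n (leqnn _))[s [sn so sf sp sF]]; exists s; split => // p ps.
  by have [] := sF p ps.
elim=> [_|m IHm mn]; first by exists [::]; split => //; rewrite nil_free.
have [s [sm so sf sp sF]] := IHm (ltnW mn).
set q := unzip1 s in so sf sp sF.
have [z Fz zmax] := exists_half_max F0 (fun x => normr_ge0 (residual q x))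
  (fun x Fx => le_trans (norm_residual_le x so) (FN x Fx)).
have [x0 x0q] : exists x0, residual q x0 != 0.
  have : ~~ ({:H} <= <<q>>)%VS.
    apply: contraL mn => /dimvS h; rewrite -leqNgt (leq_trans h)//.
    by rewrite (leq_trans (dim_span _))// size_map sm.
  move=> /subvPn[x0 _ xq]; exists x0; apply: contra xq => /eqP r0.
  by have := sub_residual_span q x0; rewrite r0 subr0.
(* If all residuals vanish on [F], the direction comes from the auxiliary vector
   [x0] instead. *)
pose y := if residual q z == 0 then x0 else z.
have y0 : residual q y != 0 by rewrite /y; case: ifPn.
pose u := `|residual q y|^-1 *: residual q y.
have uq p : p \in q -> inner p u = 0.
  by move=> pq; rewrite [LHS]innerZr residual_orthogonal// mulr0.
have uu : inner u u = 1.
  rewrite [LHS]innerZl [X in _ * X]innerZr innerxx expr2.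
  by rewrite mulKf ?normr_eq0// mulVf ?normr_eq0.
have norm_u : `|u| = 1 by rewrite inner_norm uu sqrtr1.
have Fu x : F x -> `|inner x u| <= 2 * `|inner z u|.
  move=> Fx; rewrite -(inner_residual x uq) -(inner_residual z uq).
  have [rz|rz] := eqVneq (residual q z) 0.
    have := zmax _ Fx; rewrite rz normr0 mulr0 normr_le0 => /eqP ->.
    by rewrite linear0l normr0 mulr0.
  apply: le_trans (norm_inner_le _ _) _; rewrite norm_u mulr1.
  suff -> : inner (residual q z) u = `|residual q z|.
    by rewrite normr_id; exact: zmax.
  rewrite /u /y (negPf rz) [LHS]innerZr innerxx expr2 mulKf//.
  by rewrite normr_eq0.
have zu : z \in <<u :: q>>%VS.
  rewrite span_cons -[z](subrK (residual q z)) addrC memv_add//.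
    have [->|rz] := eqVneq (residual q z) 0; first exact: mem0v.
    apply/vlineP; exists `|residual q z|.
    by rewrite /u /y (negPf rz) scalerA mulfV ?normr_eq0// scale1r.
  exact: sub_residual_span.
exists ((u, z) :: s); split => /=.
- by rewrite sm.
- move: so; rewrite /orthonormal /= uu eqxx andbT => /andP[-> ->] /=.
  by rewrite andbT; apply/allP => p pq /=; rewrite innerC uq.
- rewrite free_cons sf andbT; apply/negP => /(inner_span_eq0 uq)/eqP.
  by rewrite uu oner_eq0.
- rewrite sp andbT; apply/allP => p /sF[pq _] /=.
  by rewrite (inner_span_eq0 uq pq).
- move=> p; rewrite inE => /predU1P[->|/sF[pq Fp]]; first by split.
  by split => //; rewrite span_cons (subvP (addvSr _ _)).
Qed.

(** Up to constants, [F] has the same extent in the direction [tnth w i] as its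
single point [z i], and the matrix of the coordinates of the points is
triangular. Hence the sizes of the box around [F] multiply to a minor of points
of [F]. *)
Lemma greedy_basis (F : set H) (N : R) : F !=set0 ->
  (forall x, F x -> `|x| <= N) ->
  exists (w : n.-tuple H) (z : 'I_n -> H), [/\ orthonormal_basis w,
    forall i, F (z i),
    forall i j : 'I_n, (i < j)%N -> inner (z j) (tnth w i) = 0 &
    forall i x, F x -> `|inner x (tnth w i)| <= 2 * `|inner (z i) (tnth w i)|].
Proof.
move=> F0 FN; have [s [sn so sf sp sF]] := greedy_frame F0 FN.
have wn : size (unzip1 s) == n by rewrite size_map sn.
have wE (i : 'I_n) : tnth (Tuple wn) i = (nth (0, 0) s i).1.
  by rewrite (tnth_nth 0) /= (nth_map (0, 0))// sn.
have ps (i : 'I_n) : nth (0, 0) s i \in s by rewrite mem_nth// sn.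
exists (Tuple wn), (fun i => (nth (0, 0) s i).2); split.
- rewrite /orthonormal_basis so andbT basisEfree sf subvf /=.
  by rewrite (eqP wn).
- by move=> i; have [] := sF _ (ps i).
- move=> i j ij; rewrite wE.
  apply/eqP; have /(pairwiseP (0, 0)) h := sp.
  by apply: h => //; rewrite inE sn.
- by move=> i x Fx; rewrite wE; have [_] := sF _ (ps i); apply.
Qed.

Lemma exists_orthonormal_basis : exists w : n.-tuple H, orthonormal_basis w.
Proof.
have F0 : [set (0 : H)] !=set0 by exists 0.
have FN (x : H) : [set (0 : H)] x -> `|x| <= 0 by move=> ->; rewrite normr0.
by have [w [z [wb _ _ _]]] := greedy_basis F0 FN; exists w.
Qed.

End orthonormalization.

(** * Comparison of Gram determinants *)

Section gram_theory.
Context (R : realType) (H : finHilbertType R).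
Local Notation n := (\dim {:H}).

Lemma gram_ge0 k (v : 'I_k -> H) : 0 <= gram v.
Proof. by have [w /gram_basis_ge0] := exists_orthonormal_basis H. Qed.

Lemma gram_mulmx k (M : 'M[R]_k) (v : 'I_k -> H) :
  gram (fun i => \sum_l M i l *: v l) = \det M ^+ 2 * gram v.
Proof.
rewrite /gram expr2 -{2}(det_tr M) mulrAC -!det_mulmx; congr (\det _).
apply/matrixP => i j; rewrite !mxE linear_sumlz.
under [RHS]eq_bigr do rewrite !mxE big_distrl /=.
rewrite [RHS]exchange_big /=; apply: eq_bigr => l _.
rewrite linear_sumr; apply: eq_bigr => l' _.
by rewrite [LHS]innerZl [X in _ * X]innerZr mxE; ring.
Qed.

(** The differences with base point [y i] are combinations of those with base
point [y ord_max], with coefficients in -1, 0, 1, so the Gram determinant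
changes by the square of a determinant that is at most [k!]. *)
Lemma gram_change_base k (y : 'I_k.+1 -> H) i :
  gram (fun j => y (lift i j) - y i) <=
  (k`!)%:R ^+ 2 * gram (fun j => y (lift ord_max j) - y ord_max).
Proof.
set v := fun j => y (lift ord_max j) - y ord_max.
(* For [a = ord_max] both sides vanish. *)
have yE a : y a - y ord_max = \sum_l (lift ord_max l == a)%:R *: v l.
  case: (unliftP ord_max a) => [b ->|->].
    rewrite (bigD1 b)//= eqxx scale1r big1 ?addr0// => l lb.
    by rewrite (inj_eq (@lift_inj _ _)) (negPf lb) scale0r.
  rewrite subrr big1// => l _.
  by rewrite eq_sym (negPf (neq_lift _ _)) scale0r.
pose M : 'M[R]_k := \matrix_(j, l)
  ((lift ord_max l == lift i j)%:R - (lift ord_max l == i)%:R).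
have -> : (fun j => y (lift i j) - y i) = (fun j => \sum_l M j l *: v l).
  apply/funext => j.
  have -> : y (lift i j) - y i =
    (y (lift i j) - y ord_max) - (y i - y ord_max) by rewrite opprB addrA subrK.
  rewrite !yE -sumrB; apply: eq_bigr => l _.
  by rewrite mxE scalerBl.
rewrite gram_mulmx.
rewrite ler_wpM2r ?gram_ge0// -real_normK ?num_real// lerXn2r ?nnegrE//.
have <- : (k`!)%:R * \prod_(l < k) 1 = (k`!)%:R :> R by rewrite big1_eq mulr1.
apply: norm_det_le => j l; rewrite mxE.
by case: (_ == _); case: (_ == _); rewrite /= ?mulr1n ?mulr0n ?subrr ?subr0 ?sub0r
  ?normrN ?normr1 ?normr0.
Qed.

End gram_theory.

Lemma mixed_minors_leq (R : realFieldType) k n (v : 'I_k -> 'I_k -> 'rV[R]_n)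
    (s : R) : (0 < k)%N -> (k <= n)%N ->
  (forall (h : 'I_k -> 'I_k) (f : 'I_k -> 'I_n),
    `|\det (colsub f (\matrix_j v j (h j)))| <= s) ->
  forall f : 'I_k -> 'I_k -> 'I_n,
  \prod_j `|\det (colsub (f j) (\matrix_i v j i))| <=
    ((n`!)%:R * 3 ^+ k * s) ^+ k.
Proof.
move=> k0 kn; have := subnKC kn; move: (n - k)%N => m nE.
by case: n / nE {kn} v => v; exact: mixed_minors.
Qed.

Section gram_mixed.
Context (R : realType) (H : finHilbertType R).
Local Notation n := (\dim {:H}).

(** The form of [mixed_minors] that does not depend on coordinates. *)
Lemma gram_mixed k : (0 < k)%N -> (k <= n)%N ->
  exists2 C : R, 0 < C & forall (v : 'I_k -> 'I_k -> H) (s : R),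
    (forall h : 'I_k -> 'I_k, gram (fun j => v j (h j)) <= s) ->
    \prod_j gram (v j) <= C * s ^+ k.
Proof.
move=> k0 kn; have [w wb] := exists_orthonormal_basis H.
pose C : R := (n ^ k)%:R ^+ k * (((n`!)%:R * 3 ^+ k) ^+ k) ^+ 2 * (k`!)%:R ^+ k.
have n0 : (0 < n)%N by exact: leq_trans k0 kn.
exists C.
  by rewrite !mulr_gt0 ?exprn_gt0 ?mulr_gt0 ?exprn_gt0 ?ltr0n ?fact_gt0 ?expn_gt0 ?n0.
move=> v s vs.
have s0 : 0 <= s by apply: le_trans (vs id); exact: gram_ge0.
pose t := Num.sqrt ((k`!)%:R * s).
have t2 : t ^+ 2 = (k`!)%:R * s by rewrite sqr_sqrtr// mulr_ge0.
have vt (h : 'I_k -> 'I_k) f : `|basis_minor w (fun j => v j (h j)) f| <= t.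
  rewrite -(@ler_pXn2r _ 2)// ?nnegrE ?sqrtr_ge0// t2 real_normK ?num_real//.
  by apply: le_trans (basis_minor_le_gram wb _ _) _; rewrite ler_wpM2l.
have f0 : {ffun 'I_k -> 'I_n} := [ffun=> Ordinal n0].
pose fj j := [arg max_(f > f0) `|basis_minor w (v j) f|]%O.
have fjP j (f : 'I_k -> 'I_n) :
    `|basis_minor w (v j) f| <= `|basis_minor w (v j) (fj j)|.
  rewrite /fj; case: arg_maxP => // g _ /(_ (finfun f) isT).
  apply: le_trans; rewrite le_eqVlt; apply/orP; left; apply/eqP.
  by congr (`|\det _|); apply/matrixP => a b; rewrite !mxE ffunE.
have := @mixed_minors_leq R k n
  (fun j i => \row_l inner (v j i) (tnth w l)) t k0 kn _ (fun j => fj j).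
move=> H1.
apply: le_trans (_ : \prod_j ((n ^ k)%:R * `|basis_minor w (v j) (fj j)| ^+ 2) <= _).
  apply: ler_prod => j _; rewrite gram_ge0 /=.
  by apply: (gram_le_basis_minor wb) => f; exact: fjP.
rewrite big_split /= prodr_const card_ord prodrXl.
have {}H1 : \prod_j `|basis_minor w (v j) (fj j)| <= ((n`!)%:R * 3 ^+ k * t) ^+ k.
  under eq_bigr do rewrite basis_minorE.
  by apply: H1 => h f; rewrite -(basis_minorE _ (fun j => v j (h j))).
apply: le_trans (ler_wpM2l _ (lerXn2r 2 _ _ H1)) _.
- by rewrite exprn_ge0.
- by rewrite nnegrE prodr_ge0.
- by rewrite nnegrE exprn_ge0// !mulr_ge0 ?exprn_ge0 ?sqrtr_ge0.
have tk : (t ^+ k) ^+ 2 = (k`!)%:R ^+ k * s ^+ k.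
  by rewrite -exprM mulnC exprM t2 exprMn.
by rewrite [(_ * t) ^+ k]exprMn [(_ * t ^+ k) ^+ 2]exprMn tk /C !mulrA.
Qed.

End gram_mixed.

(** * Borel sets and ellipsoids *)

Section borel.
Context (R : realType) (H : finHilbertType R).
Local Notation n := (\dim {:H}).
Implicit Types x y z : H.

Lemma open_borel (U : set H) : open U -> measurable (U : set (borel H)).
Proof. by move=> oU; apply: sub_sigma_algebra. Qed.

Lemma continuous_borel (f : H -> R) : continuous f ->
  measurable_fun [set: borel H] f.
Proof.
move=> cf; apply: (measurability _ (RGenOpens.measurableE R)).
move=> _ [_ [a [b ->] <-]]; rewrite setTI; apply: open_borel.
by have /continuousP := cf; apply; exact: interval_open.
Qed.

Lemma inner_continuous (w : H) : continuous (inner^~ w).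
Proof.
move=> x; apply/cvgrPdist_le => /= e e0.
have d0 : 0 < e / (`|w| + 1) by rewrite divr_gt0// ltr_wpDl.
near=> y.
rewrite -linearBl; apply: le_trans (norm_inner_le _ _) _.
apply: (@le_trans _ _ (e / (`|w| + 1) * (`|w| + 1))); last first.
  by rewrite divfK// gt_eqF// ltr_wpDl.
apply: ler_pM => //; last by rewrite lerDl.
Unshelve. all: by end_near. Qed.

Lemma inner_borel (x0 w : H) :
  measurable_fun [set: borel H] (fun x : borel H => inner ((x : H) - x0) w).
Proof.
apply: (@continuous_borel (fun x : H => inner (x - x0) w)) => x.
apply: (@continuous_comp _ _ _ (fun x => x - x0) (inner^~ w)).
  by apply: cvgB; [exact: cvg_id|exact: cvg_cst].
exact: inner_continuous.
Qed.

Lemma ellipsoid_borel (x0 : H) (w : n.-tuple H) (l : 'I_n -> \bar R) :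
  measurable (ellipsoid x0 w l : set (borel H)).
Proof.
pose f (x : borel H) : \bar R :=
  (\sum_(i < n) (`|inner ((x : H) - x0) (tnth w i)| ^+ 2)%:E / l i ^+ 2)%E.
have mf : measurable_fun setT f.
  apply: emeasurable_sum => i; apply: emeasurable_funM; last exact: measurable_cst.
  apply/measurable_EFinP; apply: measurable_funX.
  by apply: measurableT_comp => //; exact: inner_borel.
have -> : (ellipsoid x0 w l : set (borel H)) = setT `&` [set x | (f x <= cst 1%E x)%E].
  by rewrite setTI.
exact: emeasurable_fun_le.
Qed.

(** A box is contained in the ellipsoid whose axes are longer by [Num.sqrt n]. An
axis of length 0 is allowed: its term is then [0 * +oo = 0]. *)
Lemma sub_ellipsoid (x0 : H) (w : n.-tuple H) (a : 'I_n -> R) x :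
  (forall i, `|inner (x - x0) (tnth w i)| <= a i) ->
  ellipsoid x0 w (fun i => (Num.sqrt n%:R * a i)%:E) x.
Proof.
move=> xa; rewrite /ellipsoid /=.
have [n0|n0] := posnP n.
  rewrite big1 ?lee_fin// => i _.
  have : (0 < n)%N by exact: leq_ltn_trans (leq0n i) (ltn_ord i).
  by move/lt0n_neq0; rewrite {1}n0.
apply: (@le_trans _ _ (\sum_(i < n) (n%:R^-1)%:E)%E); last first.
  rewrite sumEFin lee_fin sumr_const card_ord -[leLHS]mulr_natr mulVf//.
  by rewrite pnatr_eq0 -lt0n.
apply: lee_sum => i _.
have a0 : 0 <= a i by apply: le_trans (xa i).
have [ai0|ai0] := eqVneq (a i) 0.
  have -> : `|inner (x - x0) (tnth w i)| = 0.
    by apply/eqP; rewrite eq_le normr_ge0 andbT -ai0.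
  by rewrite expr0n /= mul0e lee_fin invr_ge0.
have ai : 0 < a i by rewrite lt_def ai0.
rewrite -EFinM -expr2 inver exprMn sqr_sqrtr// mulf_eq0 pnatr_eq0 -leqn0 leqNgt n0/=.
rewrite expf_eq0 (negPf ai0) /= -EFinM lee_fin.
rewrite ler_pdivrMr; last by rewrite mulr_gt0 ?ltr0n ?exprn_gt0.
by rewrite mulKf ?pnatr_eq0 -?lt0n// lerXn2r ?nnegrE.
Qed.

Lemma ellipsoid_coord_le (x0 : H) (w : n.-tuple H) (l : 'I_n -> \bar R) i (r : R) x :
  (forall j, (0 <= l j)%E) -> l i = r%:E -> ellipsoid x0 w l x ->
  `|inner (x - x0) (tnth w i)| <= r.
Proof.
move=> l0 li; rewrite /ellipsoid /= => xl.
have r0 : 0 <= r by have := l0 i; rewrite li lee_fin.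
have term j : (0 <= (`|inner (x - x0) (tnth w j)| ^+ 2)%:E / l j ^+ 2)%E.
  apply: mule_ge0; first by rewrite lee_fin exprn_ge0.
  by rewrite inve_ge0 expe_ge0.
have : ((`|inner (x - x0) (tnth w i)| ^+ 2)%:E / l i ^+ 2 <= 1)%E.
  apply: le_trans xl; rewrite (bigD1 i)//= leeDl//.
  by apply: sume_ge0 => j _.
rewrite li -EFin_expe inver expf_eq0 /=.
have [->|rn0] := eqVneq r 0.
  have [->//|u0] := eqVneq (`|inner (x - x0) (tnth w i)|) 0.
  by rewrite /= gt0_muley ?leye_eq// lte_fin exprn_gt0// lt_def u0/=.
rewrite -EFinM lee_fin ler_pdivrMr ?mul1r ?exprn_gt0 ?lt_def ?rn0//.
by rewrite ler_pXn2r// nnegrE.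
Qed.

End borel.

(** * Measure of a bounded set *)

Lemma increasing_enum (n : nat) (S : {set 'I_n}) k : #|S| = k ->
  exists2 f : 'I_k -> 'I_n, {homo f : a b / (a < b)%N >-> (a < b)%N} &
    forall (R : comNzRingType) (F : 'I_n -> R),
      \prod_(i in S) F i = \prod_a F (f a).
Proof.
case: k /; exists (@enum_val _ (mem S)) => [a b ab|R F]; last exact: big_enum_val.
have x0 := enum_val a; rewrite !(enum_val_nth x0).
have ltn_tr : transitive (fun i j : 'I_n => (i < j)%N).
  by move=> x y z; exact: ltn_trans.
have sS : sorted (fun i j : 'I_n => (i < j)%N) (enum S).
  rewrite /(enum _) sorted_filter// -enumT.
  have := iota_ltn_sorted 0 n; rewrite -val_enum_ord sorted_map.
  by apply: sub_sorted.
by apply: (sorted_ltn_nth ltn_tr) => //; rewrite inE -cardE.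
Qed.

Section bounded_sets.
Context (R : realType) (H : finHilbertType R).
Local Notation n := (\dim {:H}).
Variable mu : {sigma_finite_measure set (borel H) -> \bar R}.

Lemma kcontent_le k (c : R) (a : 'I_n -> R) (b : R) : 0 <= c ->
  (forall S : {set 'I_n}, #|S| = k -> \prod_(i in S) a i <= b) ->
  (kcontent k (fun i => (c * a i)%:E) <= (c ^+ k * b)%:E)%E.
Proof.
move=> c0 ab; apply: ub_ereal_sup => _ [S Sk <-].
rewrite prodEFin lee_fin big_split /= prodr_const Sk.
by rewrite ler_wpM2l ?exprn_ge0// ab.
Qed.

(** The ellipsoid around the box of [greedy_basis] has a [k]-content comparable
with the largest product of [k] of the numbers [a i]. By triangularity this
product is a minor of the chosen points, hence at most a constant times the
square root of their Gram determinant. *)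
Lemma bounded_measure_le_gram k (alpha : R) : (k <= n)%N -> 0 <= alpha ->
  ellipsoid_bound mu k alpha ->
  exists2 C : R, 0 <= C & forall (x0 : H) (F : set (borel H)) (N : R),
    measurable F -> F !=set0 -> (forall x : H, F x -> `|x - x0| <= N) ->
    exists2 z : 'I_k -> H, (forall i, F (z i)) &
      (mu F <= (C * Num.sqrt (gram (fun i => z i - x0)) `^ alpha)%:E)%E.
Proof.
move=> kn al0 [C C0 mC].
pose D : R := (2 * Num.sqrt n%:R) ^+ k * Num.sqrt (k`!)%:R.
have D0 : 0 <= D by rewrite mulr_ge0 ?exprn_ge0 ?mulr_ge0 ?sqrtr_ge0.
exists (C * D `^ alpha); first by rewrite mulr_ge0 ?powR_ge0.
move=> x0 F N mF [x1 Fx1] FN.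
have F0 : [set x : H | F (x + x0)] !=set0 by exists (x1 - x0); rewrite /= subrK.
have F'N x : [set x : H | F (x + x0)] x -> `|x| <= N.
  by move=> /FN; rewrite addrK.
have [w [z [wb zF ztri zmax]]] := greedy_basis F0 F'N.
pose a i := `|inner (z i) (tnth w i)|.
have a0 i : 0 <= a i by exact: normr_ge0.
have [S0 S0k] : exists S : {set 'I_n}, #|S| == k.
  exists [set widen_ord kn i | i : 'I_k].
  by rewrite card_imset ?card_ord// => i j /(congr1 val)/= /val_inj.
pose S := [arg max_(S > S0 | #|S| == k) \prod_(i in S) a i]%O.
have [Sk Smax] : #|S| = k /\
    forall T : {set 'I_n}, #|T| = k -> \prod_(i in T) a i <= \prod_(i in S) a i.
  rewrite /S; case: arg_maxP => // T /eqP Tk Tmax; split => // U /eqP.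
  exact: Tmax.
have [f fmono fprod] := increasing_enum Sk.
exists (fun i => z (f i) + x0) => [i|]; first exact: zF.
have -> : (fun i => z (f i) + x0 - x0) = (fun i => z (f i)).
  by apply/funext => i; rewrite addrK.
set g := gram _; have g0 : 0 <= g by exact: gram_ge0.
have ag : \prod_(i in S) a i <= Num.sqrt (k`!)%:R * Num.sqrt g.
  rewrite fprod -sqrtrM// -(@ler_pXn2r _ 2)// ?nnegrE ?prodr_ge0//.
  rewrite sqr_sqrtr ?mulr_ge0//; apply: le_trans (basis_minor_le_gram wb _ f).
  rewrite -normr_prod real_normK ?num_real// /basis_minor -det_tr det_trig.
    rewrite le_eqVlt; apply/orP; left; apply/eqP; congr (_ ^+ 2).
    by apply: eq_bigr => i _; rewrite !mxE.
  by apply/is_trig_mxP => i j ij; rewrite !mxE ztri// fmono.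
pose l (i : 'I_n) := (Num.sqrt n%:R * (2 * a i))%:E.
have l0 i : (0 <= l i)%E by rewrite lee_fin !mulr_ge0 ?sqrtr_ge0.
have FE : F `<=` ellipsoid x0 w l.
  move=> x Fx; apply: sub_ellipsoid => i; apply: zmax.
  by rewrite /= subrK.
apply: (@le_trans _ _ (mu (ellipsoid x0 w l : set (borel H)))).
  by apply: le_measure => //; rewrite inE//; exact: ellipsoid_borel.
apply: le_trans (mC x0 w l wb l0) _.
rewrite -mulrA -powRM// ?sqrtr_ge0// EFinM lee_wpmul2l ?lee_fin//.
rewrite -poweR_EFin.
have lK : (kcontent k l <= (D * Num.sqrt g)%:E)%E.
  have -> : l = fun i => ((2 * Num.sqrt n%:R) * a i)%:E.
    by apply/funext => i; rewrite /l; congr (_%:E); ring.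
  apply: le_trans (kcontent_le (b := Num.sqrt (k`!)%:R * Num.sqrt g) _ _) _.
  - by rewrite mulr_ge0 ?sqrtr_ge0.
  - by move=> T /Smax h; exact: le_trans h ag.
  - by rewrite lee_fin mulrA.
have K0 : (0 <= kcontent k l)%E.
  apply: (@le_trans _ _ (\prod_(i in S) l i)%E); first exact: prode_ge0.
  by apply: ereal_sup_ubound; exists S.
apply: gt0_ler_poweR => //; rewrite in_itv /= ?K0 ?leey//.
by rewrite lee_fin mulr_ge0 ?sqrtr_ge0.
Qed.

End bounded_sets.

(** * Products and powers *)

Section real_products.
Context (R : realType).

Lemma powR_prod (I : finType) (P : pred I) (u : I -> R) (b : R) :
  (forall i, 0 <= u i) ->
  (\prod_(i | P i) u i) `^ b = \prod_(i | P i) u i `^ b.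
Proof.
move=> u0; suff [] : \prod_(i | P i) u i `^ b = (\prod_(i | P i) u i) `^ b /\
  0 <= \prod_(i | P i) u i by [].
elim/big_ind2 : _ => [|x1 x2 y1 y2 [-> ?] [-> ?]|//]; first by rewrite powR1.
by rewrite powRM// mulr_ge0.
Qed.

Lemma powR_sumr (I : finType) (P : pred I) (x : R) (b : I -> R) : 0 < x ->
  x `^ (\sum_(i | P i) b i) = \prod_(i | P i) x `^ b i.
Proof.
move=> x0; elim/big_ind2 : _ => [|x1 x2 y1 y2 <- <-|//]; first by rewrite powRr0.
by rewrite powRD// (gt_eqF x0) implybT.
Qed.

(** On the right [M i] occurs in the [i]-th factor only and [W i] in all the
others. *)
Lemma prod_interpolation m (W M b : 'I_m -> R) :
  (forall i, 0 < W i) -> (forall i, 0 < M i) ->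
  \prod_i (W i `^ (\sum_(j | j != i) b j) * M i `^ b i) =
  \prod_i (M i * \prod_(j | j != i) W j) `^ b i.
Proof.
move=> W0 M0.
under [RHS]eq_bigr => i _.
  rewrite powRM ?prodr_ge0 ?ltW// => [|j _]; last exact/ltW.
  rewrite powR_prod; last by move=> j; exact/ltW.
  over.
rewrite !big_split /= mulrC; congr (_ * _).
rewrite (exchange_big_dep xpredT)//=; apply: eq_bigr => i _.
by rewrite powR_sumr//; apply: eq_bigl => j; rewrite eq_sym.
Qed.

(** Fixing all factors but one shows that each set is bounded above; choosing
points above half of the suprema gives the constant [2 ^+ m]. *)
Lemma prod_sup_le m (Z : 'I_m -> set R) (B : R) :
  (forall j u, Z j u -> 0 < u) -> (forall j, Z j !=set0) ->
  (forall u : 'I_m -> R, (forall j, Z j (u j)) -> \prod_j u j <= B) ->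
  (forall j, has_sup (Z j)) /\ \prod_j sup (Z j) <= 2 ^+ m * B.
Proof.
move=> Z0 Zn ZB; have /choice[u0 u0Z] := Zn.
have Zsup j : has_sup (Z j).
  split; first exact: Zn.
  pose P := \prod_(l | l != j) u0 l.
  have P0 : 0 < P by apply: prodr_gt0 => l _; exact: Z0 (u0Z l).
  exists (B / P) => v Zv; rewrite ler_pdivlMr//.
  have := ZB (fun l => if l == j then v else u0 l).
  rewrite (bigD1 j)//= eqxx.
  have -> : \prod_(l | l != j) (if l == j then v else u0 l) = P.
    by apply: eq_bigr => l /negPf ->.
  by apply => l; case: eqP => [->|].
split=> //.
have sup0 j : 0 < sup (Z j).
  apply: lt_le_trans (Z0 _ _ (u0Z j)) _; apply: ub_le_sup => //.
  by have [] := Zsup j.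
have /choice[u uZ] : forall j, exists u, Z j u /\ sup (Z j) <= 2 * u.
  move=> j; have [v Zv vs] := sup_adherent (divr_gt0 (sup0 j) (ltr0n R 2)) (Zsup j).
  by exists v; split => //; lra.
apply: (@le_trans _ _ (\prod_j (2 * u j))).
  by apply: ler_prod => j _; rewrite (ltW (sup0 j)) /=; have [] := uZ j.
rewrite big_split /= prodr_const card_ord ler_wpM2l ?exprn_ge0//.
by apply: ZB => j; have [] := uZ j.
Qed.

Lemma lt_EFin_between (r : R) (x : \bar R) : (r%:E < x)%E ->
  exists2 c : R, r < c & (c%:E < x)%E.
Proof.
case: x => [x| |//]; last by exists (r + 1); rewrite ?ltrDl ?ltry.
rewrite lte_fin => rx; exists ((r + x) / 2); rewrite ?lte_fin; lra.
Qed.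

Lemma lee_prod (I : finType) (F G : I -> \bar R) :
  (forall i, 0 <= F i)%E -> (forall i, F i <= G i)%E ->
  (\prod_i F i <= \prod_i G i)%E.
Proof.
move=> F0 FG; suff [] : (0 <= \prod_i F i)%E /\ (\prod_i F i <= \prod_i G i)%E by [].
elim/big_ind2 : _ => [|x1 x2 y1 y2 [? ?] [? ?]|i _//]; first by split.
by split; [exact: mule_ge0|exact: lee_pmul].
Qed.

End real_products.

(** * The endpoint estimate *)

Section product_estimate.
Context (R : realType) (H : finHilbertType R).
Local Notation n := (\dim {:H}).
Variable mu : {sigma_finite_measure set (borel H) -> \bar R}.

Lemma lt_measure_truncate (F : nat -> set (borel H)) (c : R) :
  (forall N, measurable (F N)) -> nondecreasing_seq F ->
  (c%:E < mu (\bigcup_N F N))%E -> exists N, (c%:E < mu (F N))%E.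
Proof.
move=> mF ndF cF; apply/not_existsP => h; move: cF; rewrite ltNge => /negP; apply.
have cv := @nondecreasing_cvg_mu _ _ _ mu F mF (bigcupT_measurable _ mF) ndF.
rewrite -(cvg_lim _ cv)//; apply: lime_le; first by apply/cvg_ex; eexists; exact: cv.
by apply: nearW => N /=; rewrite leNgt; apply/negP; exact: h.
Qed.

Lemma cball_borel (x0 : H) (r : R) :
  measurable ([set x | `|x - x0| <= r] : set (borel H)).
Proof.
have mf : measurable_fun [set: borel H] (fun x : borel H => `|(x : H) - x0|).
  apply: (@continuous_borel _ _ (fun x : H => `|x - x0|)) => x.
  apply: (@continuous_comp _ _ _ (fun x => x - x0) (fun x => `|x|)).
    by apply: cvgB; [exact: cvg_id|exact: cvg_cst].
  exact: norm_continuous.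
rewrite -[X in measurable X]setTI.
exact: (measurable_fun_le measurableT mf (measurable_cst r)).
Qed.

(** The endpoint estimate: apply [bounded_measure_le_gram] to each set and
compare the resulting [k] volumes with the mixed one by [gram_mixed]. The sets
need not be bounded, because [c i] leaves room for a truncation. *)
Lemma prod_le_gram k (alpha : R) : (0 < k)%N -> (k <= n)%N -> 0 <= alpha ->
  ellipsoid_bound mu k alpha ->
  exists2 C : R, 0 <= C &
  forall (x0 : H) (F : 'I_k -> set (borel H)) (c : 'I_k -> R) (s : R),
    (forall i, measurable (F i)) -> (forall i, 0 < c i) ->
    (forall i, ((c i)%:E < mu (F i))%E) ->
    (forall y : 'I_k -> H, (forall i, F i (y i)) ->
      Num.sqrt (gram (fun i => y i - x0)) <= s) ->
    \prod_i c i <= C * s `^ (k%:R * alpha).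
Proof.
move=> k0 kn al0 mub.
have [C1 C10 mixed] := gram_mixed (H := H) k0 kn.
have [C2 C20 bounded] := bounded_measure_le_gram kn al0 mub.
exists (C2 ^+ k * Num.sqrt C1 `^ alpha).
  by rewrite mulr_ge0 ?exprn_ge0 ?powR_ge0.
move=> x0 F c s mF c0 cF Fs.
pose B (N : nat) : set (borel H) := [set x : H | `|x - x0| <= N%:R].
have mB N : measurable (B N) by exact: cball_borel.
have FB i : exists N, ((c i)%:E < mu (F i `&` B N))%E.
  apply: lt_measure_truncate => [N|M N MN|].
  - exact: measurableI.
  - apply/subsetPset => x [Fx xM]; split => //; apply: le_trans xM _.
    by rewrite ler_nat.
  - rewrite -setI_bigcupr (_ : \bigcup_N B N = setT) ?setIT//.
    apply/seteqP; split => // x _; exists (Num.truncn `|(x : H) - x0|).+1 => //.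
    exact/ltW/Num.Theory.truncnS_gt.
have Fz i : exists2 z : 'I_k -> H, (forall j, F i (z j)) &
    c i <= C2 * Num.sqrt (gram (fun j => z j - x0)) `^ alpha.
  have [N cN] := FB i.
  have FN0 : F i `&` B N !=set0.
    apply/set0P/eqP => FN0; move: cN; rewrite FN0 measure0 lte_fin.
    by rewrite ltNge (ltW (c0 i)).
  have [z zF zmu] := bounded x0 (F i `&` B N) N%:R (measurableI _ _ (mF i) (mB N))
    FN0 (fun x Fx => Fx.2).
  exists z => [j|]; first by have [] := zF j.
  by rewrite -lee_fin; exact: le_trans (ltW cN) zmu.
pose z i := projT1 (cid2 (Fz i)).
have zF i j : F i (z i j) by rewrite /z; case: cid2 => /= z' zF _.
have zc i : c i <= C2 * Num.sqrt (gram (fun j => z i j - x0)) `^ alpha.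
  by rewrite /z; case: cid2.
have s0 : 0 <= s by apply: le_trans (Fs (fun i => z i i) _) => //; exact: sqrtr_ge0.
have gz : \prod_i gram (fun j => z i j - x0) <= C1 * (s ^+ 2) ^+ k.
  apply: mixed => h; rewrite -[leLHS]sqr_sqrtr ?gram_ge0//.
  rewrite lerXn2r ?nnegrE ?sqrtr_ge0//.
  exact: (Fs (fun i => z i (h i))).
apply: le_trans (_ : \prod_i (C2 * Num.sqrt (gram (fun j => z i j - x0)) `^ alpha) <= _).
  by apply: ler_prod => i _; rewrite ltW//= zc.
rewrite big_split /= prodr_const card_ord -mulrA ler_wpM2l ?exprn_ge0//.
rewrite -powR_prod; last by move=> i; exact: sqrtr_ge0.
rewrite powRrM powR_mulrn// -powRM ?sqrtr_ge0 ?exprn_ge0//.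
apply: ge0_ler_powR => //; rewrite ?nnegrE ?prodr_ge0 ?mulr_ge0 ?sqrtr_ge0 ?exprn_ge0//.
rewrite -(@ler_pXn2r _ 2)// ?nnegrE ?prodr_ge0 ?mulr_ge0 ?sqrtr_ge0 ?exprn_ge0//.
rewrite -prodrXl exprMn sqr_sqrtr ?(ltW C10)// exprAC.
by under eq_bigr do rewrite sqr_sqrtr ?gram_ge0//.
Qed.

(** Remove from [E] the countably many coordinate boxes with rational centres and
radii [1 / m] that meet [E] in a null set. Every point that is left sees a
positive part of [E] in each of its neighbourhoods, so essential suprema over
[E] bound continuous functions pointwise on the subset. *)
Lemma exists_essential_subset (E : set (borel H)) : measurable E ->
  exists E' : set (borel H), [/\ measurable E', E' `<=` E, mu E' = mu E &
    forall (x : H) (d : R), E' x -> 0 < d ->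
      (0 < mu (E `&` [set y : H | (`|y - x| <= d)%R]))%E].
Proof.
move=> mE; have [w wb] := exists_orthonormal_basis H.
pose U (j : {ffun 'I_n -> rat} * nat) : set (borel H) :=
  [set x : H | forall i, `|inner x (tnth w i) - ratr (j.1 i)| < j.2.+1%:R^-1].
have mU j : measurable (U j).
  have -> : U j = \bigcap_(i in [set: 'I_n]) (fun x : borel H => inner (x : H) (tnth w i)) @^-1`
      (ball (ratr (j.1 i) : R) j.2.+1%:R^-1).
    apply/seteqP; split => x /= xj i; first by move=> _; rewrite -ball_normE /= distrC; exact: xj.
    by have := xj i I; rewrite -ball_normE /= distrC.
  apply: fin_bigcap_measurable => // i _.
  rewrite -[X in measurable X]setTI.
  apply: (@continuous_borel _ H (inner^~ (tnth w i))) => //.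
    exact: inner_continuous.
  by apply: open_measurable; exact: ball_open.
(* The null boxes, enumerated through the countable type of boxes. *)
pose V (a : nat) : set (borel H) :=
  if unpickle a is Some j then if mu (E `&` U j) == 0%E then U j else set0 else set0.
have mV a : measurable (V a).
  by rewrite /V; case: unpickle => // j; case: ifP.
have muV a : mu.-negligible (E `&` V a).
  apply/negligibleP; first exact: measurableI.
  by rewrite /V; case: unpickle => [j|]; [case: ifP => [/eqP//|]|]; rewrite setI0 measure0.
have mVV : measurable (\bigcup_a V a) by exact: bigcupT_measurable.
exists (E `\` \bigcup_a V a); split.
- exact: measurableD.
- by move=> x [].
- rewrite [RHS](measureDI mu mE mVV) [X in (_ + X)%E](_ : _ = 0%E) ?adde0//.
  apply/negligibleP; first exact: measurableI.
  by rewrite setI_bigcupr; exact: negligible_bigcup.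
- move=> x d [Ex xV] d0; pose m := Num.truncn (2 * n%:R / d).
  have m0 : 0 < m.+1%:R^-1 :> R by rewrite invr_gt0.
  have xq i : exists q : rat, `|inner x (tnth w i) - ratr q| < m.+1%:R^-1.
    have [|q] := @rat_in_itvoo R (inner x (tnth w i) - m.+1%:R^-1)
        (inner x (tnth w i) + m.+1%:R^-1).
      by rewrite ltrD2l gt0_cp.
    by rewrite in_itv/= => xq; exists q; rewrite distrC ltr_distl.
  pose j : {ffun 'I_n -> rat} * nat := ([ffun i => sval (cid (xq i))], m).
  have xj : U j x by move=> i; rewrite /= ffunE; case: cid.
  have Uj : U j `<=` [set y : H | `|y - x| <= d].
    move=> y yj /=; rewrite (orthonormal_sum wb (y - x)).
    apply: le_trans (ler_norm_sum _ _ _) _.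
    apply: (@le_trans _ _ (\sum_(i < n) (2 * m.+1%:R^-1))).
      apply: ler_sum => i _.
      have wi : `|tnth w i| = 1.
        by rewrite inner_norm (orthonormal_tnth wb) eqxx sqrtr1.
      rewrite normrZ wi mulr1 linearBl /=.
      have -> : inner y (tnth w i) - inner x (tnth w i) =
        (inner y (tnth w i) - ratr (j.1 i)) - (inner x (tnth w i) - ratr (j.1 i)).
        by rewrite opprB addrA subrK.
      apply: le_trans (ler_normB _ _) _.
      by rewrite mulr_natl mulr2n lerD// ltW.
    rewrite sumr_const card_ord -[leLHS]mulr_natr mulrAC ler_pdivrMr ?ltr0n//.
    by rewrite -ler_pdivrMl// mulrC ltW// Num.Theory.truncnS_gt.
  have EUj : (0 < mu (E `&` U j))%E.
    rewrite lt0e measure_ge0 andbT; apply/negP => EUj; apply: xV.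
    by exists (pickle j) => //; rewrite /V pickleK EUj.
  apply: lt_le_trans EUj _; apply: le_measure; rewrite ?inE.
  - exact: measurableI.
  - by apply: measurableI => //; exact: cball_borel.
  - exact: setIS.
Qed.

End product_estimate.

(** * Essential bounds on the determinant *)

Section continuity.
Context (R : realType) (H : finHilbertType R).
Local Notation n := (\dim {:H}).

(** The Gram determinant is a polynomial in inner products of the vertices, hence
continuous. *)
Lemma gram_perturb k (y : 'I_k.+1 -> H) (c : R) (b : 'I_k.+1) (a : 'I_k -> 'I_k.+1) :
  c < Num.sqrt (gram (fun j => y (a j) - y b)) ->
  exists2 d : R, 0 < d & forall y' : 'I_k.+1 -> H,
    (forall j, `|y' j - y j| <= d) ->
    c < Num.sqrt (gram (fun j => y' (a j) - y' b)).
Proof.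
move=> cy.
(* The filter of the tuples that converge to [y] vertex by vertex. *)
pose F : set_system ('I_k.+1 -> H) := filter_from [set d : R | 0 < d]
  (fun d => [set y' : 'I_k.+1 -> H | forall j, `|y' j - y j| <= d]).
have FF : Filter F.
  apply: filter_from_filter; first by exists 1 => /=.
  move=> d e /= d0 e0; exists (Num.min d e); first by rewrite lt_min d0.
  by move=> y' yd; split => j; have := yd j; rewrite le_min => /andP[].
have [w wb] := exists_orthonormal_basis H.
have Fj j : y' j @[y' --> F] --> y j.
  apply/cvgrPdist_le => e e0; exists e => //= y' yd.
  by rewrite distrC; exact: yd.
have Fi i j : inner (y' (a i) - y' b) (y' (a j) - y' b) @[y' --> F] -->
    inner (y (a i) - y b) (y (a j) - y b).
  rewrite (parseval wb).
  under eq_fun do rewrite (parseval wb).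
  have Fl l j' : inner (y' (a j') - y' b) (tnth w l) @[y' --> F] -->
      inner (y (a j') - y b) (tnth w l).
    exact: (cvg_comp _ _ (cvgB (Fj (a j')) (Fj b)) (@inner_continuous _ _ _ _)).
  apply: (cvg_big add_continuous) => l _; apply: cvgM; exact: Fl.
have FG : Num.sqrt (gram (fun j => y' (a j) - y' b)) @[y' --> F] -->
    Num.sqrt (gram (fun j => y (a j) - y b)).
  suff gr : gram (fun j => y' (a j) - y' b) @[y' --> F] -->
      gram (fun j => y (a j) - y b).
    exact: (cvg_comp _ _ gr (@sqrt_continuous R _)).
  apply: (cvg_big add_continuous) => s _; apply: cvgM; first exact: cvg_cst.
  apply: (cvg_big mul_continuous) => i _; rewrite mxE.
  by under eq_fun do rewrite mxE; exact: Fi.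
have [d d0 dF] : F [set y' | c < Num.sqrt (gram (fun j => y' (a j) - y' b))].
  exact: (cvgr_gt _ FG).
by exists d => // y' /dF.
Qed.

End continuity.

Section level_sets.
Context (R : realType) (H : finHilbertType R).
Local Notation n := (\dim {:H}).
Variable mu : {sigma_finite_measure set (borel H) -> \bar R}.

Lemma gram_detE k (y : k.+1.-tuple H) : gram_det y =
  Num.sqrt (gram (fun j => tnth y (lift ord_max j) - tnth y ord_max)).
Proof.
rewrite /gram_det /gram; congr (Num.sqrt (\det _)).
have wl (i : 'I_k) : widen_ord (leqnSn k) i = lift ord_max i.
  by apply: val_inj; rewrite /= /bump leqNgt ltn_ord.
by apply/matrixP => i j; rewrite !mxE !wl.
Qed.

(** A box with sides of positive measure has positive product measure, so it is
not contained in a null set. *)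
Lemma box_meets_ae m (A : 'I_m -> set (borel H)) :
  (forall i, measurable (A i)) -> (forall i, 0 < mu (A i))%E ->
  forall P : set (m.-tuple (borel H)),
  (\forall y \ae power_measure mu m, P y) ->
  exists2 y : m.-tuple (borel H), (forall i, A i (tnth y i)) & P y.
Proof.
move=> mA A0 P [N [mN N0 PN]].
apply/not_exists2P => noy.
have mbox : measurable [set t : m.-tuple (borel H) | forall i, A i (tnth t i)].
  rewrite (_ : [set _ | _] = \bigcap_(i in [set: 'I_m])
      ((fun t : m.-tuple (borel H) => tnth t i) @^-1` A i)); last first.
    by apply/seteqP; split => t /= tA i; [move=> _; exact: tA|exact: (tA i)].
  apply: fin_bigcap_measurable => // i _.
  by rewrite -[X in measurable X]setTI; exact: measurable_tnth.
have : (power_measure mu m [set t | forall i, A i (tnth t i)] <= 0)%E.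
  rewrite -N0; apply: le_measure; rewrite ?inE// => y Ay; apply: PN => /= Py.
  by case: (noy y).
rewrite power_measure_box// leNgt => /negP; apply.
by elim/big_ind : _ => // x y; exact: mule_gt0.
Qed.

(** If the volume exceeded [s] at [y], it would do so near [y], on a box of
positive measure; there [g] would exceed its almost sure bound [A]. *)
Lemma essential_gram_le k (E E' : 'I_k.+1 -> set (borel H))
    (g : k.+1.-tuple (borel H) -> \bar R) (A : \bar R) (s : R) :
  (\forall y \ae power_measure mu k.+1, (g y <= A)%E) ->
  (forall j, measurable (E j)) ->
  (forall j (x : H) (d : R), E' j x -> 0 < d ->
    (0 < mu (E j `&` [set y : H | (`|y - x| <= d)%R]))%E) ->
  (forall y : k.+1.-tuple H, (forall j, E j (tnth y j)) ->
    s < gram_det y -> (A < g y)%E) ->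
  forall y : 'I_k.+1 -> H, (forall j, E' j (y j)) ->
  Num.sqrt (gram (fun j => y (lift ord_max j) - y ord_max)) <= s.
Proof.
move=> gA mE E'0 Eg y E'y; rewrite leNgt; apply/negP => /gram_perturb[d d0 dy].
have [y' Ey' gy'] := box_meets_ae
  (fun j => measurableI _ _ (mE j) (cball_borel (y j) d))
  (fun j => E'0 j (y j) d (E'y j) d0) gA.
suff : (A < g y')%E by rewrite ltNge gy'.
apply: Eg => [j|]; first by have [] := Ey' j.
rewrite gram_detE; apply: (dy (fun j => tnth y' j)) => j.
by have [] := Ey' j.
Qed.

(** On the product of the level sets the product of the [f j] is at least [T], so
the volume is at most [(A / T) `^ gamma^-1] at all essential points. Any
essential point of the level set [i] serves as base point for [prod_le_gram].
In terms of [q = k alpha / gamma] the conclusion reads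
[(t i) `^ q * \prod_(j != i) ((t j) `^ q * c j) <= C * A `^ q]. *)
Lemma prod_level_sets_le k (alpha gamma : R) : (0 < k)%N -> (k <= n)%N ->
  0 < alpha -> 0 < gamma -> ellipsoid_bound mu k alpha ->
  exists2 C : R, 0 <= C &
  forall (f : 'I_k.+1 -> borel H -> R) (A : R) (t : 'I_k.+1 -> R) (i : 'I_k.+1)
      (c : 'I_k -> R),
    (forall j, measurable_fun setT (f j)) ->
    (ess_sup (power_measure mu k.+1)
      (fun y => ((\prod_(j < k.+1) f j (tnth y j)) * gram_det y `^ gamma)%:E)
      <= A%:E)%E -> 0 <= A ->
    (forall j, 0 < t j) -> (forall j, (0 < mu [set x | (t j < f j x)%R])%E) ->
    (forall j, 0 < c j) ->
    (forall j, ((c j)%:E < mu [set x | (t (lift i j) < f (lift i j) x)%R])%E) ->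
    \prod_j c j <= C * (A / \prod_j t j) `^ (k%:R * alpha / gamma).
Proof.
move=> k0 kn al0 ga0 mub.
have [C C0 prodC] := prod_le_gram k0 kn (ltW al0) mub.
exists (C * (k`!)%:R `^ (k%:R * alpha)); first by rewrite mulr_ge0 ?powR_ge0.
move=> f A t i c mf /ess_supP fA A0 t0 ft0 c0 cf.
set T := \prod_j t j.
have T0 : 0 < T by apply: prodr_gt0.
pose E j : set (borel H) := [set x | t j < f j x].
have mE j : measurable (E j).
  have -> : E j = setT `&` f j @^-1` `]t j, +oo[%classic.
    by apply/seteqP; split=> x; rewrite /E /= in_itv/= andbT => // -[].
  exact: mf.
have /choice[E' E'P] := fun j => exists_essential_subset mu (mE j).
pose s := (A / T) `^ gamma^-1.
have s0 : 0 <= s := powR_ge0 _ _.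
have AT0 : 0 <= A / T by rewrite divr_ge0// ltW.
have E's (y : 'I_k.+1 -> H) : (forall j, E' j (y j)) ->
    Num.sqrt (gram (fun j => y (lift ord_max j) - y ord_max)) <= s.
  move=> yE'; apply: (essential_gram_le fA mE) yE' => [j x d|z zE sz].
    by have [_ _ _] := E'P j; exact.
  rewrite lte_fin.
  have : A / T < gram_det z `^ gamma.
    have -> : A / T = s `^ gamma by rewrite -powRrM mulVf ?gt_eqF// powRr1.
    by apply: gt0_ltr_powR => //; rewrite nnegrE// gram_detE sqrtr_ge0.
  rewrite ltr_pdivrMr// mulrC => /lt_le_trans; apply.
  rewrite ler_wpM2r ?powR_ge0//; apply: ler_prod => j _.
  by rewrite ltW//= ltW//; exact: zE.
have [x0 x0E] : E' i !=set0.
  apply/set0P/eqP => E'i; have [_ _] := E'P i; rewrite E'i measure0 => Ei _.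
  by have := ft0 i; rewrite -/(E i) -Ei ltxx.
have Fs (y : 'I_k -> H) : (forall j, E' (lift i j) (y j)) ->
    Num.sqrt (gram (fun j => y j - x0)) <= (k`!)%:R * s.
  move=> yE'; pose z j := if unlift i j is Some j' then y j' else x0.
  have zE' j : E' j (z j).
    by rewrite /z; case: unliftP => [j'|] ->.
  have -> : (fun j => y j - x0) = (fun j => z (lift i j) - z i).
    by apply/funext => j; rewrite /z liftK unlift_none.
  have := E's z zE'; set g := gram _; set g' := gram _ => gs.
  apply: (@le_trans _ _ (Num.sqrt ((k`!)%:R ^+ 2 * g))).
    by rewrite ler_wsqrtr// gram_change_base.
  by rewrite sqrtrM ?exprn_ge0// sqrtr_sqr ger0_norm// ler_wpM2l.
apply: le_trans (prodC x0 (fun j => E' (lift i j)) c _ _ c0 _ Fs) _.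
- by move=> j; have [] := E'P (lift i j).
- by move=> j; have [_ _ -> _] := E'P (lift i j); exact: cf.
rewrite powRM// mulrA ler_wpM2l ?mulr_ge0 ?powR_ge0//.
by rewrite /s -powRrM [gamma^-1 * _]mulrC.
Qed.

End level_sets.

(** * Weak type interpolation *)

Section layer_cake.
Context d (T : measurableType d) (R : realType).
Variable mu : {measure set T -> \bar R}.

Lemma cvg_geometric_eseries (a r : R) : 0 <= r < 1 ->
  eseries (fun m => (a * r ^+ m)%:E) @ \oo --> (a / (1 - r))%:E.
Proof.
move=> /andP[r0 r1]; apply: cvg_EFin => //.
  by apply: nearW => //= x; rewrite /eseries/= sumEFin.
rewrite [X in X @ _ --> _](_ : _ = series (geometric a r)); last first.
  by apply/funext => x; rewrite /= /eseries/= sumEFin.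
by apply: cvg_geometric_series; rewrite ger0_norm.
Qed.

Lemma dyadic_scale (M y : R) : 0 < y -> y <= M ->
  exists m : nat, M * 2^-1 ^+ m.+1 < y <= M * 2^-1 ^+ m.
Proof.
move=> y0 yM; have M0 : 0 < M by exact: lt_le_trans y0 yM.
have exm : exists m : nat, M * 2^-1 ^+ m.+1 < y.
  have h : (fun m => 2^-1 ^+ m : R) @ \oo --> (0 : R).
    by apply: cvg_expr; rewrite ger0_norm// invf_lt1// ltr1n.
  have [N _ NP] := cvgr_lt _ h (y / M) (divr_gt0 y0 M0).
  exists N; rewrite mulrC -ltr_pdivlMr//; apply: NP => /=; exact: leqnSn.
exists (ex_minn exm); case: ex_minnP => -[|m] -> min /=.
  by rewrite expr0 mulr1.
by rewrite leNgt; apply/negP => /min; rewrite ltnn.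
Qed.

(** Interpolation between weak [L^q] and [L^oo]. For [0 < y <= M] the dyadic
scale of [y] bounds [y `^ p] by one term of a series of indicators of level
sets, whose integrals decay geometrically since [q < p]. *)
Lemma integral_le_weak (p q : R) : 0 < p -> q < p ->
  exists2 C : R, 0 <= C & forall (f : T -> R) (M W : R),
    measurable_fun setT f -> (forall x, 0 <= f x) -> 0 < M -> 0 <= W ->
    (forall t, 0 < t -> (mu [set x | (t < f x)%R] <= (W * t `^ (- q))%:E)%E) ->
    mu [set x | (M < f x)%R] = 0%E ->
    (\int[mu]_x (`|f x| `^ p)%:E <= (C * (W * M `^ (p - q)))%:E)%E.
Proof.
move=> p0 qp; pose h : R := 2^-1; pose r : R := h `^ (p - q).
have h0 : 0 < h by rewrite invr_gt0.
have h1 : h < 1 by rewrite invf_lt1// ltr1n.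
have r0 : 0 <= r by exact: powR_ge0.
have r1 : r < 1.
  have pq : 0 < p - q by rewrite subr_gt0.
  by have := gt0_ltr_powR pq (ltW h0) (ler01 : 1 \in Num.nneg) h1; rewrite powR1.
exists (h `^ (- q) / (1 - r)); first by rewrite divr_ge0 ?powR_ge0// subr_ge0 ltW.
move=> f M W mf f0 M0 W0 fW fM.
pose a m := (M * h ^+ m) `^ p.
pose E m := [set x | M * h ^+ m.+1 < f x].
have mE t : measurable [set x | t < f x].
  have -> : [set x | t < f x] = setT `&` f @^-1` `]t, +oo[%classic.
    by apply/seteqP; split=> x; rewrite /= in_itv/= andbT => // -[].
  exact: mf.
pose g x : \bar R := (\sum_(m <oo) (a m * \1_(E m) x)%:E)%E.
have a0 m : 0 <= a m by exact: powR_ge0.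
have term0 m x : (0 <= (a m * \1_(E m) x)%:E)%E by rewrite lee_fin mulr_ge0.
have mterm m : measurable_fun setT (fun x => (a m * \1_(E m) x)%:E).
  apply/measurable_EFinP; apply: measurable_funM => //.
  by apply: measurable_indic; exact: mE.
apply: (@le_trans _ _ (\int[mu]_x g x)%E).
  apply: ae_ge0_le_integral => //.
  - apply/measurable_EFinP.
    by apply: (measurableT_comp (measurable_powR p)); exact: measurableT_comp.
  - by move=> x _; apply: nneseries_ge0 => m _ _.
  - apply: ge0_emeasurable_sum => //.
  exists [set x | M < f x]; split => // x /= h'; rewrite ltNge; apply/negP => fxM.
  apply: h' => _; have [fx0|fx0] := eqVneq (f x) 0.
    rewrite fx0 normr0 powR0 ?gt_eqF//.
    by apply: nneseries_ge0 => m _ _.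
  have fx : 0 < f x by rewrite lt_def fx0 f0.
  have [m /andP[m1 m2]] := dyadic_scale fx fxM.
  apply: le_trans (nneseries_lim_ge m.+1 (fun m _ _ => term0 m x)).
  rewrite big_nat_recr//=; apply: (@le_trans _ _ (a m * \1_(E m) x)%:E); last first.
    by rewrite leeDr// sume_ge0.
  rewrite indicE mem_set// mulr1 lee_fin ger0_norm//.
  by apply: ge0_ler_powR; rewrite ?nnegrE// ltW// mulr_gt0// exprn_gt0.
rewrite integral_nneseries//.
pose K := W * M `^ (p - q) * h `^ (- q).
apply: (@le_trans _ _ (\sum_(m <oo) (K * r ^+ m)%:E)%E); last first.
  rewrite (cvg_lim _ (@cvg_geometric_eseries K r (introT andP (conj r0 r1))))//.
  rewrite lee_fin /K le_eqVlt; apply/orP; left; apply/eqP; ring.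
apply: lee_nneseries => [m _ _|m _]; first exact: integral_ge0.
rewrite (integralZl_indic _ (fun=> E m))//; last first.
- exact: mE.
- by move=> am; have := a0 m; rewrite leNgt am.
rewrite integral_indic//; last exact: mE.
rewrite setIT; apply: (@le_trans _ _ ((a m)%:E * (W * (M * h ^+ m.+1) `^ (- q))%:E)%E).
  by apply: lee_wpmul2l; rewrite ?lee_fin//; apply: fW; rewrite mulr_gt0 ?exprn_gt0.
rewrite -EFinM lee_fin le_eqVlt; apply/orP; left; apply/eqP.
have hm s j : (M * h ^+ j) `^ s = M `^ s * (h `^ s) ^+ j.
  rewrite (powRM _ (ltW M0) (exprn_ge0 _ (ltW h0))).
  by rewrite -(powR_mulrn j (ltW h0)) -(powR_mulrn j (powR_ge0 h s)) powRAC.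
rewrite /a /K /r !hm exprS.
have -> : M `^ (p - q) = M `^ p * M `^ (- q)
  by rewrite powRD// (gt_eqF M0) implybT.
have -> : h `^ (p - q) = h `^ p * h `^ (- q)
  by rewrite powRD// (gt_eqF h0) implybT.
by rewrite exprMn; ring.
Qed.

End layer_cake.

(** * From ellipsoids to the determinant inequality *)

Section interpolation.
Context (R : realType) (H : finHilbertType R).
Local Notation n := (\dim {:H}).
Variable mu : {sigma_finite_measure set (borel H) -> \bar R}.

Lemma LnormE d (T : measurableType d) (nu : {measure set T -> \bar R}) (p : R)
    (f : T -> R) :
  ('N[nu]_p%:E [EFin \o f] = (\int[nu]_x (`|f x| `^ p)%:E) `^ p^-1)%E.
Proof. by rewrite unlock /=; congr (_ `^ _)%E; apply: eq_integral. Qed.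

(** With [q = k alpha / gamma] the hypotheses on the exponents say that [q < p j]
and that the [(p j)^-1] add up to [k / q]. Let [m j] be the [q]-th power of the
essential supremum of [f j] and [W j] its weak [L^q] quasinorm to the power
[q]. Then [prod_level_sets_le] gives
[m i * \prod_(j != i) W j <= B0 * A `^ q] for every [i], while
[integral_le_weak] bounds the [L^(p j)] norm by
[W j `^ (p j)^-1 * m j `^ b j] with [b j = q^-1 - (p j)^-1 >= 0]. The [b i] add
up to [q^-1] and the [b j] with [j != i] to [(p i)^-1], so the product of the
norms is the weighted geometric mean of these [k + 1] inequalities. *)
Lemma det_inequality_finite k (alpha gamma : R) (p : 'I_k.+1 -> R) :
  (0 < k)%N -> (k <= n)%N -> 0 < alpha -> 0 < gamma -> ellipsoid_bound mu k alpha ->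
  (forall j, 0 < p j) ->
  (forall j, (p j)^-1 < gamma / (k%:R * alpha)) ->
  \sum_(j < k.+1) (p j)^-1 = gamma / alpha ->
  exists2 C : R, 0 <= C &
  forall (f : 'I_k.+1 -> borel H -> R) (A : R),
    (forall j, measurable_fun setT (f j)) -> (forall j x, 0 <= f j x) ->
    (ess_sup (power_measure mu k.+1)
      (fun y => ((\prod_(j < k.+1) f j (tnth y j)) * gram_det y `^ gamma)%:E)
      <= A%:E)%E -> 0 <= A ->
    (\prod_(j < k.+1) 'N[mu]_(p j)%:E [EFin \o f j] <= (C * A)%:E)%E.
Proof.
move=> k0 kn al0 ga0 mub p0 pq psum.
have [C C0 prodC] := prod_level_sets_le k0 kn al0 ga0 mub.
pose q := k%:R * alpha / gamma.
have kR : 0 < k%:R :> R by rewrite ltr0n.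
have q0 : 0 < q by rewrite divr_gt0 ?mulr_gt0.
have qV : q^-1 = gamma / (k%:R * alpha) by rewrite invf_div.
have qp j : q < p j by rewrite -ltf_pV2 ?posrE// qV.
have psum' : \sum_(j < k.+1) (p j)^-1 = k%:R * q^-1.
  by rewrite psum qV; field; rewrite !gt_eqF.
have /choice[Cw Cw0P] j : exists Cw : R, 0 <= Cw /\
    forall (f : borel H -> R) (M W : R),
    measurable_fun setT f -> (forall x, 0 <= f x) -> 0 < M -> 0 <= W ->
    (forall t, 0 < t -> (mu [set x | (t < f x)%R] <= (W * t `^ (- q))%:E)%E) ->
    mu [set x | (M < f x)%R] = 0%E ->
    (\int[mu]_x (`|f x| `^ p j)%:E <= (Cw * (W * M `^ (p j - q)))%:E)%E.
  by have [Cw Cw0 CwP] := integral_le_weak mu (p0 j) (qp j); exists Cw.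
have Cw0 j : 0 <= Cw j by have [] := Cw0P j.
pose b j := q^-1 - (p j)^-1.
have b0 j : 0 <= b j by rewrite subr_ge0 ltW// qV.
have bsum : \sum_j b j = q^-1.
  rewrite /b sumrB sumr_const card_ord psum' -[_ *+ _]mulr_natl -natr1.
  by rewrite mulrDl mul1r addrAC subrr add0r.
have bsum' i : \sum_(j | j != i) b j = (p i)^-1.
  by move: bsum; rewrite (bigD1 i)//= /b; lra.
pose D := \prod_j (Cw j * 2 `^ (p j - q)) `^ (p j)^-1.
pose B0 := 2 ^+ k.+1 * C.
have D0 : 0 <= D by apply: prodr_ge0 => j _; exact: powR_ge0.
have B00 : 0 <= B0 by rewrite mulr_ge0 ?exprn_ge0.
exists (D * B0 `^ q^-1); first by rewrite mulr_ge0 ?powR_ge0.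
move=> f A mf f0 fA A0.
have [/existsP[j /eqP fj]|/existsPn fn0] :=
    boolP [exists j, ('N[mu]_(p j)%:E [EFin \o f j] == 0)%E].
  by rewrite (bigD1 j)//= fj mul0e lee_fin !mulr_ge0 ?powR_ge0.
have ft0 j : exists2 t, 0 < t & (0 < mu [set x | (t < f j x)%R])%E.
  apply: contrapT => /forall2NP h; have := fn0 j; rewrite LnormE => /negP; apply.
  have ft t : 0 < t -> mu [set x | (t < f j x)%R] = 0%E.
    move=> t0; have [//|/negP] := h t; rewrite -leNgt => ft.
    by apply/eqP; rewrite eq_le ft measure_ge0.
  have [_ /(_ (f j) 1 0 (mf j) (f0 j) ltr01 (lexx 0))] := Cw0P j.
  rewrite mul0r mulr0 => h1.
  have -> : (\int[mu]_x (`|f j x| `^ p j)%:E = 0)%E.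
    apply/eqP; rewrite eq_le integral_ge0// andbT h1 ?ft// => t t0.
    by rewrite ft// mul0r.
  by rewrite poweR0r// invr_eq0 gt_eqF.
(* The suprema of [X j] and [Y j] are the quantities [W j] and [m j]. *)
pose X j : set R := [set u | exists t c : R, [/\ 0 < t, 0 < c,
   (c%:E < mu [set x | (t < f j x)%R])%E & u = t `^ q * c]].
pose Y j : set R := [set u | exists t : R, [/\ 0 < t,
   (0 < mu [set x | (t < f j x)%R])%E & u = t `^ q]].
have Xn j : X j !=set0.
  have [t t0 /lt_EFin_between[c c0 tc]] := ft0 j.
  by exists (t `^ q * c), t, c.
have Yn j : Y j !=set0.
  by have [t t0 tc] := ft0 j; exists (t `^ q), t.
pose Z i j := if j == i then Y i else X j.
have key i := @prod_sup_le R k.+1 (Z i) (C * A `^ q).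
have {}key i : (forall j, has_sup (Z i j)) /\ \prod_j sup (Z i j) <= 2 ^+ k.+1 * (C * A `^ q).
  apply: key => [j u|j|u uZ].
  - rewrite /Z; case: ifP => _; first by move=> [t [t0 _ ->]]; rewrite powR_gt0.
    by move=> [t [c [t0 c0 _ ->]]]; rewrite mulr_gt0 ?powR_gt0.
  - by rewrite /Z; case: ifP.
  have [ti [ti0 tic uiE]] : Y i (u i) by have := uZ i; rewrite /Z eqxx.
  have /choice[tc tcP] (j : 'I_k) : exists tc : R * R, [/\ 0 < tc.1, 0 < tc.2,
     (tc.2%:E < mu [set x | (tc.1 < f (lift i j) x)%R])%E &
     u (lift i j) = tc.1 `^ q * tc.2].
    have := uZ (lift i j); rewrite /Z eq_sym (negPf (neq_lift _ _)).
    by move=> [t [c h]]; exists (t, c).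
  pose t j := if unlift i j is Some j' then (tc j').1 else ti.
  have t0 j : 0 < t j.
    by rewrite /t; case: unliftP => // j' _; have [] := tcP j'.
  have tmu j : (0 < mu [set x | (t j < f j x)%R])%E.
    rewrite /t; case: unliftP => [j' ->|->//].
    by have [_ c0 + _] := tcP j'; apply: lt_trans; rewrite lte_fin.
  have tl j : t (lift i j) = (tc j).1 by rewrite /t liftK.
  have ti' : t i = ti by rewrite /t unlift_none.
  have := prodC f A t i (fun j => (tc j).2) mf fA A0 t0 tmu.
  have T0 : 0 < \prod_j t j by apply: prodr_gt0.
  rewrite -/q powRM ?invr_ge0 ?(ltW T0)// -(powR_inv1 (ltW T0)) -powRrM mulN1r.
  rewrite powRN mulrA => h.
  have {h} : \prod_j (tc j).2 <= C * A `^ q / (\prod_j t j) `^ q.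
    apply: h => j; first by have [] := tcP j.
    by rewrite tl; have [] := tcP j.
  rewrite ler_pdivlMr ?powR_gt0//; apply: le_trans.
  rewrite le_eqVlt; apply/orP; left; apply/eqP.
  rewrite powR_prod => [|j]; last exact: ltW.
  rewrite !(bigD1_ord i)//= uiE ti' mulrCA; congr (_ * _).
  rewrite -big_split /=; apply: eq_bigr => j _.
  by rewrite tl mulrC; have [_ _ _ ->] := tcP j.
pose W j := sup (X j); pose m j := sup (Y j).
have Ysup j : has_sup (Y j).
  by have [/(_ j)] := key j; rewrite /Z eqxx.
have Xsup j : has_sup (X j).
  have [i ij] : exists i, j != i.
    by exists (if j == ord0 then ord_max else ord0); case: ifP => [/eqP ->|/negbT//];
     rewrite -val_eqE /= eq_sym -lt0n.
  by have [/(_ j)] := key i; rewrite /Z (negPf ij).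
have W0 j : 0 < W j.
  have [_ [t [c [t0 c0 tc _]]]] := Xn j.
  apply: (@lt_le_trans _ _ (t `^ q * c)); first by rewrite mulr_gt0 ?powR_gt0.
  by apply: ub_le_sup; [case: (Xsup j)|exists t, c].
have m0 j : 0 < m j.
  have [_ [t [t0 tc _]]] := Yn j.
  apply: (@lt_le_trans _ _ (t `^ q)); first by rewrite powR_gt0.
  by apply: ub_le_sup; [case: (Ysup j)|exists t].
have mW i : m i * \prod_(j | j != i) W j <= B0 * A `^ q.
  have [_] := key i; rewrite (bigD1 i)//= /Z eqxx -mulrA mulrA -/(m i) -/B0.
  by under eq_bigr => j /negPf -> do rewrite -/(W j).
(* The factor 2 makes the level set above [M j] null whether or not the supremum
   is attained. *)
pose M j := 2 * m j `^ q^-1.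
have fM j : mu [set x | (M j < f j x)%R] = 0%E.
  apply/eqP; rewrite eq_le measure_ge0 andbT leNgt; apply/negP => h.
  have Mj : 0 < M j by rewrite mulr_gt0 ?powR_gt0.
  have : M j `^ q <= m j by apply: ub_le_sup; [case: (Ysup j)|exists (M j)].
  rewrite /M powRM ?powR_ge0// -powRrM mulVf ?gt_eqF// (powRr1 (ltW (m0 j))).
  apply/negP; rewrite -ltNge -[ltLHS]mul1r ltr_pM2r//.
  by have := gt0_ltr_powR q0 (ler01 : 1 \in Num.nneg) (ler0n R 2) (ltr1n R 2); rewrite powR1.
have fW j t : 0 < t -> (mu [set x | (t < f j x)%R] <= (W j * t `^ (- q))%:E)%E.
  move=> t0; rewrite leNgt; apply/negP => /lt_EFin_between[c Wc tc].
  have c0 : 0 < c by apply: le_lt_trans Wc; rewrite mulr_ge0 ?powR_ge0 ?ltW.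
  have : t `^ q * c <= W j by apply: ub_le_sup; [case: (Xsup j)|exists t, c].
  apply/negP; rewrite -ltNge.
  by move: Wc; rewrite powRN ltr_pdivrMr ?powR_gt0// mulrC.
pose G j := (Cw j * 2 `^ (p j - q)) `^ (p j)^-1 * (W j `^ (p j)^-1 * m j `^ b j).
have NG j : ('N[mu]_(p j)%:E [EFin \o f j] <= (G j)%:E)%E.
  have [_ /(_ (f j) (M j) (W j) (mf j) (f0 j) _ (ltW (W0 j)) (fW j) (fM j))] := Cw0P j.
  rewrite mulr_gt0 ?powR_gt0// => /(_ isT) h.
  rewrite LnormE; have -> : G j = (Cw j * (W j * M j `^ (p j - q))) `^ (p j)^-1.
    have -> : Cw j * (W j * M j `^ (p j - q)) =
        (Cw j * 2 `^ (p j - q)) * (W j * m j `^ (q^-1 * (p j - q))).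
      by rewrite /M powRM ?powR_ge0// -powRrM; ring.
    have W0j : 0 <= W j by exact: ltW.
    rewrite /G [in RHS]powRM; [|by rewrite mulr_ge0 ?powR_ge0..].
    rewrite [in RHS](powRM _ W0j); last exact: powR_ge0.
    rewrite -[in RHS]powRrM (_ : b j = q^-1 * (p j - q) / p j)// /b.
    by field; rewrite !gt_eqF.
  rewrite -poweR_EFin; apply: gt0_ler_poweR => //.
  - by rewrite invr_ge0 ltW.
  - rewrite in_itv /= leey andbT; apply: integral_ge0 => x _.
    by rewrite lee_fin powR_ge0.
  - by rewrite in_itv /= leey andbT lee_fin !mulr_ge0 ?powR_ge0// ltW.
apply: le_trans (lee_prod _ NG) _; first by move=> j; exact: Lnorm_ge0.
rewrite prodEFin lee_fin /G big_split /= -/D -mulrA ler_wpM2l//.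
under eq_bigr => j _ do rewrite -(bsum' j).
rewrite prod_interpolation//.
apply: (@le_trans _ _ (\prod_i (B0 * A `^ q) `^ b i)).
  apply: ler_prod => i _; rewrite powR_ge0 /=; apply: ge0_ler_powR => //.
  - by rewrite nnegrE mulr_ge0 ?ltW// prodr_gt0.
  - by rewrite nnegrE mulr_ge0 ?powR_ge0.
have BA0 : 0 < B0 * A `^ q.
  by apply: lt_le_trans (mW ord0); rewrite mulr_gt0// prodr_gt0.
rewrite -powR_sumr// bsum powRM ?powR_ge0// -powRrM mulfV ?gt_eqF//.
by rewrite powRr1.
Qed.

(** For [mu = 0] the essential supremum is [-oo], so the constant has to be 0;
otherwise the essential supremum is nonnegative. *)
Lemma det_inequality_of_ellipsoid_bound k (alpha gamma : R) (p : 'I_k.+1 -> R) :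
  (0 < k)%N -> (k <= n)%N -> 0 < alpha -> ellipsoid_bound mu k alpha ->
  (forall j, 0 < p j) ->
  (forall j, (p j)^-1 < gamma / (k%:R * alpha)) ->
  \sum_(j < k.+1) (p j)^-1 = gamma / alpha ->
  det_inequality mu p gamma.
Proof.
move=> k0 kn al0 mub p0 pq psum.
have ga0 : 0 < gamma.
  have : 0 < gamma / (k%:R * alpha).
    by apply: lt_trans (pq ord0); rewrite invr_gt0.
  by rewrite pmulr_lgt0// invr_gt0 mulr_gt0// ltr0n.
have [muT0|muT0] := eqVneq (mu setT) 0%E.
  exists 0 => // f fP; rewrite mul0e (bigD1 ord0)//= LnormE.
  rewrite (_ : (\int[mu]_x _ = 0)%E) ?poweR0r ?mul0e ?invr_eq0 ?gt_eqF//.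
  have [mf f0 _] := fP ord0.
  have := @null_set_integral _ _ R mu setT (fun x => (`|f ord0 x| `^ p ord0)%:E).
  apply => //; apply/measurable_EFinP.
  by apply: (measurableT_comp (measurable_powR _)); exact: measurableT_comp.
have [C C0 mC] := det_inequality_finite k0 kn al0 ga0 mub p0 pq psum.
exists (C + 1); first by rewrite addr_ge0.
move=> f fP; set S := ess_sup _ _.
have mf j : measurable_fun setT (f j) by have [] := fP j.
have f0 j x : 0 <= f j x by have [_ h _] := fP j; exact: h.
have S0 : (0 <= S)%E.
  have /ess_supP aeS : (S <= S)%E by [].
  have muT : (0 < mu setT)%E by rewrite lt0e muT0 measure_ge0.
  have [y _ yS] := box_meets_ae (A := fun _ : 'I_k.+1 => setT)
    (fun=> measurableT) (fun=> muT) aeS.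
  by apply: le_trans yS; rewrite lee_fin mulr_ge0 ?powR_ge0// prodr_ge0.
case SE : S S0 => [A| |//] S0; last by rewrite gt0_muley ?leey// lte_fin ltr_wpDl.
have fA : (S <= A%:E)%E by rewrite SE.
apply: le_trans (mC f A mf f0 fA _) _; first by rewrite -lee_fin.
by rewrite -EFinM lee_fin ler_wpM2r// lerDl.
Qed.

End interpolation.

(** * From the determinant inequality to ellipsoids *)

Section test_functions.
Context (R : realType) (H : finHilbertType R).
Local Notation n := (\dim {:H}).
Variable mu : {sigma_finite_measure set (borel H) -> \bar R}.

Lemma prode_eqy (I : finType) (l : I -> \bar R) i :
  (forall j, 0 < l j)%E -> l i = +oo%E -> (\prod_j l j = +oo)%E.
Proof.
move=> l0 li; rewrite (bigD1 i)//= li gt0_mulye//.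
by elim/big_ind : _ => // x y; exact: mule_gt0.
Qed.

(** If one of the selected axes has length 0, the minor has a zero column.
Otherwise all of them are finite, since their product is bounded by the
[k]-content, and the Leibniz formula applies. *)
Lemma basis_minor_ellipsoid_le k (x0 : H) (w : n.-tuple H) (l : 'I_n -> \bar R)
    (K : R) (x y : 'I_k -> H) (f : 'I_k -> 'I_n) :
  (forall i, 0 <= l i)%E -> (kcontent k l <= K%:E)%E -> 0 <= K ->
  (forall i, ellipsoid x0 w l (x i)) -> (forall i, ellipsoid x0 w l (y i)) ->
  `|basis_minor w (fun i => x i - y i) f| <= (k`!)%:R * 2 ^+ k * K.
Proof.
move=> l0 lK K0 Bx By.
have C0 : 0 <= (k`!)%:R * 2 ^+ k * K by rewrite !mulr_ge0 ?exprn_ge0.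
have [/injectiveP f_inj|/injectiveP f_ninj] := boolP (injectiveb f); last first.
  by rewrite basis_minorE det_colsub_ninj ?normr0.
have lf : (\prod_j l (f j) <= K%:E)%E.
  apply: le_trans lK; apply: ereal_sup_ubound.
  exists (f @: 'I_k)%SET; first by rewrite /= card_imset// card_ord.
  rewrite big_imset/=; last by move=> i j _ _; exact: f_inj.
  by apply: eq_bigl => j; rewrite inE.
have coord i j r : l (f j) = r%:E -> `|inner (x i - y i) (tnth w (f j))| <= 2 * r.
  move=> lr; have -> : x i - y i = (x i - x0) - (y i - x0) by rewrite opprB addrA subrK.
  rewrite linearBl/= mulr_natl mulr2n; apply: le_trans (ler_normB _ _) _.
  by rewrite lerD//; exact: ellipsoid_coord_le lr _.
have [/existsP[j /eqP lj]|/existsPn lf0] := boolP [exists j, l (f j) == 0%E].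
  rewrite /basis_minor (expand_det_col _ j) big1 ?normr0// => i _.
  rewrite mxE; have := coord i j 0 lj.
  by rewrite mulr0 normr_le0 => /eqP ->; rewrite mul0r.
have lfin j : l (f j) = (fine (l (f j)))%:E.
  rewrite fineK// ge0_fin_numE// ltey; apply/eqP => lj; move: lf.
  rewrite (@prode_eqy _ (fun j => l (f j)) j)// => j'.
  by rewrite lt0e lf0 l0.
apply: le_trans (norm_det_le (b := fun j => 2 * fine (l (f j))) _) _.
  by move=> i j; rewrite mxE; exact: coord.
rewrite big_split /= prodr_const card_ord mulrA ler_wpM2l ?mulr_ge0 ?exprn_ge0//.
by rewrite -lee_fin -prodEFin; under eq_bigr do rewrite -lfin.
Qed.

Lemma gram_det_ellipsoid_le k : exists2 c : R, 0 <= c &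
  forall (x0 : H) (w : n.-tuple H) (l : 'I_n -> \bar R) (K : R) (y : k.+1.-tuple H),
  orthonormal_basis w ->
  (forall i, 0 <= l i)%E -> (kcontent k l <= K%:E)%E -> 0 <= K ->
  (forall i, ellipsoid x0 w l (tnth y i)) -> gram_det y <= c * K.
Proof.
exists (Num.sqrt (n ^ k)%:R * ((k`!)%:R * 2 ^+ k)).
  by rewrite !mulr_ge0 ?sqrtr_ge0 ?exprn_ge0.
move=> x0 w l K y wb l0 lK K0 By.
have C0 : 0 <= (k`!)%:R * 2 ^+ k * K by rewrite !mulr_ge0 ?exprn_ge0.
have := gram_le_basis_minor wb (fun f => basis_minor_ellipsoid_le f l0 lK K0
  (fun i => By (lift ord_max i)) (fun i : 'I_k => By ord_max)).
rewrite gram_detE => /ler_wsqrtr /le_trans; apply.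
by rewrite sqrtrM// sqrtr_sqr ger0_norm// !mulrA.
Qed.

Lemma Lnorm_indic (p : R) (A : set (borel H)) : 0 < p -> measurable A ->
  ('N[mu]_p%:E [EFin \o \1_A] = mu A `^ p^-1)%E.
Proof.
move=> p0 mA; rewrite LnormE; congr (_ `^ _)%E.
rewrite -[X in (_ = mu X)%E]setIT -integral_indic//; apply: eq_integral => x _.
by rewrite indicE; case: (_ \in _); rewrite ?normr1 ?normr0 ?powR1 ?powR0// gt_eqF.
Qed.

(** Test the inequality with the indicators of the part of the ellipsoid in a set
of finite measure, and exhaust. The volume is at most [c * K] on the ellipsoid,
[K] being its [k]-content. The constant [D + 1] is positive so that it also
covers ellipsoids of infinite content. *)
Lemma ellipsoid_bound_of_det_inequality k (p : 'I_k.+1 -> R) (gamma : R) :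
  (k <= n)%N -> (forall j, 0 < p j) -> 0 < gamma ->
  det_inequality mu p gamma ->
  ellipsoid_bound mu k (gamma * (\sum_(j < k.+1) (p j)^-1)^-1).
Proof.
move=> kn p0 ga0 [C C0 mC]; set sg := \sum_(j < k.+1) _.
have sg0 : 0 < sg.
  rewrite /sg (bigD1 ord0)//= ltr_pwDl ?invr_gt0// sumr_ge0// => j _.
  by rewrite invr_ge0 ltW.
have al0 : 0 < gamma * sg^-1 by rewrite mulr_gt0 ?invr_gt0.
have [c c0 gc] := gram_det_ellipsoid_le k.
pose D := (C * c `^ gamma) `^ sg^-1.
have D0 : 0 <= D by exact: powR_ge0.
exists (D + 1); first by rewrite addr_ge0.
move=> x0 w l wb l0; set B := ellipsoid x0 w l.
have mB : measurable (B : set (borel H)) by exact: ellipsoid_borel.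
have kc0 : (0 <= kcontent k l)%E.
  apply: (@le_trans _ _ (\prod_(i in [set widen_ord kn i | i : 'I_k]) l i)%E).
    by apply: prode_ge0.
  apply: ereal_sup_ubound; eexists; last by [].
  by rewrite /= card_imset ?card_ord// => i j /(congr1 val)/= /val_inj.
have [kcy|kcfin] := eqVneq (kcontent k l) +oo%E.
  by rewrite kcy poweRyr ?gt_eqF// gt0_muley ?leey// lte_fin ltr_wpDl.
have [K KE] : exists K, kcontent k l = K%:E.
  exists (fine (kcontent k l)); rewrite fineK// ge0_fin_numE//.
  by rewrite ltey.
have K0 : 0 <= K by rewrite -lee_fin -KE.
have lK : (kcontent k l <= K%:E)%E by rewrite KE.
rewrite KE poweR_EFin -EFinM leNgt; apply/negP => muB.
have /sigma_finiteP[F [TF ndF Foo]] := sigma_finiteT mu.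
have [m muBm] : exists m, (((D + 1) * K `^ (gamma * sg^-1))%:E < mu (B `&` F m))%E.
  apply: lt_measure_truncate => [m|a b ab|].
  - by apply: measurableI => //; have [] := Foo m.
  - by apply/subsetPset; apply: setIS; exact/subsetPset/ndF.
  - by rewrite -setI_bigcupr -TF setIT.
have [mFm Fmoo] := Foo m.
set Bm := (B `&` F m : set (borel H)).
have mBm : measurable Bm by exact: measurableI.
have Bmfin : mu Bm \is a fin_num.
  rewrite ge0_fin_numE//; apply: le_lt_trans Fmoo.
  by apply: le_measure; rewrite ?inE//; exact: subIsetr.
pose u := fine (mu Bm).
have uE : mu Bm = u%:E by rewrite fineK.
have u0 : 0 < u.
  rewrite -lte_fin -uE; apply: le_lt_trans muBm.
  by rewrite lee_fin mulr_ge0 ?powR_ge0// addr_ge0.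
have normB j : ('N[mu]_(p j)%:E [EFin \o \1_Bm] = (u `^ (p j)^-1)%:E)%E.
  by rewrite Lnorm_indic// uE poweR_EFin.
have ess_le : (ess_sup (power_measure mu k.+1)
    (fun y => ((\prod_(j < k.+1) \1_Bm (tnth y j)) * gram_det y `^ gamma)%:E)
    <= ((c * K) `^ gamma)%:E)%E.
  apply/ess_supP; apply: nearW => y; rewrite lee_fin.
  have [By|/existsNP[j yj]] := pselect (forall j, Bm (tnth y j)).
    rewrite big1 ?mul1r => [|j _]; last by rewrite indicE mem_set.
    apply: ge0_ler_powR; first exact: ltW.
    - by rewrite nnegrE gram_detE sqrtr_ge0.
    - by rewrite nnegrE mulr_ge0.
    - by apply: (gc x0 w l K y wb l0 lK K0) => j; have [] := By j.
  by rewrite (bigD1 j)//= indicE memNset// !mul0r powR_ge0.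
have := mC (fun=> \1_Bm).
have -> : (\prod_(j < k.+1) 'N[mu]_(p j)%:E [EFin \o \1_Bm] = (u `^ sg)%:E)%E.
  by rewrite (eq_bigr _ (fun j _ => normB j)) prodEFin -powR_sumr.
move=> H1.
have : u `^ sg <= C * (c * K) `^ gamma.
  rewrite -lee_fin; apply: le_trans (H1 _) _ => [j|].
    split; first exact: measurable_indic.
      by move=> x; rewrite indicE.
    by rewrite /finite_norm normB ltry.
  by rewrite EFinM lee_wpmul2l// lee_fin.
rewrite powRM// mulrA => h.
have : u <= D * K `^ (gamma * sg^-1).
  have -> : u = (u `^ sg) `^ sg^-1 by rewrite -powRrM mulfV ?gt_eqF// powRr1// ltW.
  have Cc0 : 0 <= C * c `^ gamma by rewrite mulr_ge0 ?powR_ge0.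
  rewrite /D [K `^ _]powRrM -(powRM sg^-1 Cc0 (powR_ge0 K gamma)).
  apply: ge0_ler_powR h; first by rewrite invr_ge0 ltW.
  - by rewrite nnegrE powR_ge0.
  - by rewrite nnegrE mulr_ge0 ?powR_ge0.
apply/negP; rewrite -ltNge; move: muBm; rewrite -/Bm uE lte_fin.
by apply: le_lt_trans; rewrite ler_wpM2r ?powR_ge0// lerDl.
Qed.

End test_functions.

Theorem theorem3p1 (R : realType) (H : finHilbertType R) (k : nat)
    (k_gt0 : (1 <= k)%N) (k_le : (k <= \dim {:H})%N)
    (mu : {sigma_finite_measure set (borel H) -> \bar R}) :
  (forall alpha : R, 0 < alpha -> ellipsoid_bound mu k alpha ->
    forall (p : 'I_k.+1 -> R) (gamma : R),
      (forall j, 0 < p j) ->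
      (forall j, (p j)^-1 < gamma / (k%:R * alpha)) ->
      \sum_(j < k.+1) (p j)^-1 = gamma / alpha ->
      det_inequality mu p gamma)
  /\
  (forall (p : 'I_k.+1 -> R) (gamma : R),
      (forall j, 0 < p j) -> 0 < gamma ->
      det_inequality mu p gamma ->
      ellipsoid_bound mu k (gamma * (\sum_(j < k.+1) (p j)^-1)^-1)).
Proof.
split=> [alpha al0 mub p gamma p0 pq psum|p gamma p0 ga0].
  exact: det_inequality_of_ellipsoid_bound al0 mub p0 pq psum.
exact: ellipsoid_bound_of_det_inequality.
Qed.
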